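(* Let $n\ge2$ and let $\{n_1,n_2,\dots,n_k,1\}$ be the canonical sequence of an optimal set of $n$-means for the measure $P$ below. For $1\le i\le k$ let $A(i)=\{n_1,\dots,n_{i-1},n_i+1,n_{i+1},\dots,n_k\}$ and set \[V(A(i)):=\sum_{\substack{j=1\\ j\neq i}}^k\frac{1}{n_j^2}\frac{1}{12}\frac{1}{18^j}+\frac{1}{(n_i+1)^2}\frac{1}{12}\frac{1}{18^i}+\frac{25}{204}\frac{1}{18^k},\] \[V(\infty):=\sum_{j=1}^k\frac{1}{n_j^2}\frac{1}{12}\frac{1}{18^j}+\frac{1}{12}\frac{1}{18^{k+1}}+\frac{25}{204}\frac{1}{18^{k+1}}.\] Let $V_{\min}:=\min\{\min\{V(A(j)):1\le j\le k\},V(\infty)\}$. If $V_{\min}=V(A(m))$ for some $1\le m\le k$, then $\{n_1,\dots,n_{m-1},n_m+1,n_{m+1},\dots,n_k,1\}$ is the canonical sequence which gives an optimal set of $(n+1)$-means. If $V_{\min}=V(\infty)$, then $\{n_1,n_2,\dots,n_k,1,1\}$ is the canonical sequence which gives an optimal set of $(n+1)$-means.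
   Context: $P$ is the Borel probability measure on $\mathbb{R}$ with density $f(x)=(3/2)^m$ if $x\in J_m:=[1-\frac{1}{3^{m-1}},1-\frac{2}{3^m}]$ for some $m\in\mathbb{N}=\{1,2,\dots\}$, and $f(x)=0$ otherwise. An optimal set of $n$-means for $P$ is a set $\alpha$ with $\mathrm{card}(\alpha)\le n$ attaining $\inf\{\int\min_{a\in\alpha}(x-a)^2\,dP(x):\mathrm{card}(\alpha)\le n\}$. Canonical sequence: for $n\ge2$ and an optimal set $\alpha_n$ of $n$-means for $P$, there is a (unique) positive integer $k$ with $\alpha_n\cap J_j\neq\emptyset$ for $1\le j\le k$ and $\mathrm{card}(\alpha_n\cap[1-\frac{1}{3^k},1])=1$; with $n_j:=\mathrm{card}(\alpha_n\cap J_j)$, the sequence $\{n_1,\dots,n_k,1\}$ is called the canonical sequence of order $n$ associated with $\alpha_n$. Conversely a canonical sequence determines the optimal set: $\alpha_n\cap J_j$ consists of the $n_j$ points $1-\frac{1}{3^{j-1}}+\frac{2i-1}{2n_j}\frac{1}{3^j}$, $1\le i\le n_j$, and the remaining point of $\alpha_n$ is $1-\frac{1}{2}\frac{1}{3^k}$. *)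

(* Defs.v *)
From HB Require Import structures.
From mathcomp Require Import all_boot all_order all_algebra.
From mathcomp Require Import all_classical all_reals all_analysis.
Set Implicit Arguments. Unset Strict Implicit. Unset Printing Implicit Defensive.
Import Order.TTheory GRing.Theory Num.Theory.
Local Open Scope classical_set_scope.
Local Open Scope ring_scope.

Section Defs.
Variable R : realType.

Definition inJ (m : nat) (x : R) : bool :=
  (1 - (3 ^+ m.-1)^-1 <= x) && (x <= 1 - 2 / 3 ^+ m).

Definition dens (x : R) : R :=
  match pselect (exists m : nat, (0 < m)%N /\ inJ m x) with
  | left h => (3 / 2) ^+ (projT1 (cid h))
  | right _ => 0
  end.

Definition card_pts (a : seq R) : nat := size (undup a).

(* expected squared distance to the nearest point of a, w.r.t. P = f dx *)
Definition distortion (a : seq R) : \bar R :=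
  (\int[lebesgue_measure]_x
     ((dens x)%:E * \big[Order.min/+oo%E]_(b <- a) ((x - b) ^+ 2)%:E))%E.

Definition optimal_set (n : nat) (a : seq R) : Prop :=
  (card_pts a <= n)%N /\
  distortion a = ereal_inf [set distortion b | b in [set b : seq R | (card_pts b <= n)%N]].

Definition nJ (a : seq R) (j : nat) : nat := count (inJ j) (undup a).

Definition canonical_seq_of (a : seq R) (s : seq nat) : Prop :=
  exists ns : seq nat, s = rcons ns 1%N /\
    let k := size ns in
    (1 <= k)%N /\
    (forall j, (1 <= j <= k)%N -> (0 < nJ a j)%N) /\
    count (fun x => (1 - (3 ^+ k)^-1 <= x) && (x <= 1)) (undup a) = 1%N /\
    (forall j, (1 <= j <= k)%N -> nth 0%N ns j.-1 = nJ a j).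

Definition canonical_seq (n : nat) (s : seq nat) : Prop :=
  exists a : seq R, optimal_set n a /\ canonical_seq_of a s.

(* ns = [n_1; ...; n_k];  term j (1-based) *)
Definition term (ns : seq nat) (j : nat) : R :=
  ((nth 0%N ns j.-1)%:R ^+ 2)^-1 * (1 / 12) * (18 ^+ j)^-1.

Definition VA (ns : seq nat) (i : nat) : R :=
  let k := size ns in
  \sum_(j < k | j.+1 != i) term ns j.+1
  + (((nth 0%N ns i.-1).+1)%:R ^+ 2)^-1 * (1 / 12) * (18 ^+ i)^-1
  + (25 / 204) * (18 ^+ k)^-1.

Definition Vinf (ns : seq nat) : R :=
  let k := size ns in
  \sum_(j < k) term ns j.+1
  + (1 / 12) * (18 ^+ k.+1)^-1 + (25 / 204) * (18 ^+ k.+1)^-1.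

Definition Vmin (ns : seq nat) : R :=
  \big[Num.min/Vinf ns]_(j < size ns) VA ns j.+1.

End Defs.

(* Main.v *)
Require Import Defs.
From HB Require Import structures.
From mathcomp Require Import all_boot all_order all_algebra.
From mathcomp Require Import all_classical all_reals all_analysis.
From mathcomp Require Import measurable_realfun ring lra zify.
Set Implicit Arguments. Unset Strict Implicit. Unset Printing Implicit Defensive.
Import Order.TTheory GRing.Theory Num.Theory.
Import numFieldNormedType.Exports.
Local Open Scope classical_set_scope.
Local Open Scope ring_scope.

(** The measure is self-similar: with [pull c = 3 c - 2], which maps
    [[2/3, 1]] onto [[0, 1]], the distortion satisfies
    [dist b = cost b + dist (pull b) / 18], where [cost b] is the contribution
    of the uniform part on [J_1 = [0, 1/3]].

    The cost of [n] points on [J_1] is at least [1 / (216 n^2)]: for every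
    radius [h], the squared distance to the set is at least
    [h^2 - sum_c (h^2 - (x - c)^2)^+], and each bump has integral at most
    [4 h^3 / 3].  A point outside the interior of [J_1] contributes at most half
    a bump, and nothing at all beyond distance [h].  With this, an induction on
    the number of points shows that a point of the gap [(1/3, 2/3)] can always be
    traded for a point of [J_1] or of [[2/3, 1]] with strict gain.  Hence the
    distortion of an optimal set is the value [Fval] of its canonical sequence,
    which is minimal among all sequences of positive integers with sum at most
    [n - 1].

    Starting from the value of the empty sequence, opening column [j] gains
    [2 / 18^j] and raising [n_j] from [t] to [t + 1] gains
    [(1/t^2 - 1/(t+1)^2) / (12 * 18^j)].  These gains decrease along each column,
    so an exchange argument shows that the greedy step is optimal. *)

(** * Integrals over segments *)

Section SegmentIntegral.
Variable R : realType.
Implicit Types (a b c d k : R) (f g : R -> R).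
Local Notation mu := (@lebesgue_measure R).

Definition intab a b f : R := \int[mu]_(x in `[a, b]) f x.

Lemma integrable_seg a b f : continuous f ->
  mu.-integrable `[a, b] (EFin \o f).
Proof.
move=> cf; apply: continuous_compact_integrable; first exact: segment_compact.
exact: continuous_subspaceT.
Qed.

Lemma intabE a b f : continuous f ->
  (\int[mu]_(x in `[a, b]) (f x)%:E = (intab a b f)%:E)%E.
Proof.
move=> cf; rewrite /intab /Rintegral fineK//.
exact: (integrable_fin_num _ (integrable_seg a b cf)).
Qed.

Lemma intabD a b f g : continuous f -> continuous g ->
  intab a b (fun x => f x + g x) = intab a b f + intab a b g.
Proof. by move=> cf cg; apply: RintegralD => //; exact: integrable_seg. Qed.

Lemma intabZ a b k f : continuous f ->
  intab a b (fun x => k * f x) = k * intab a b f.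
Proof. by move=> cf; apply: RintegralZl => //; exact: integrable_seg. Qed.

Lemma le_intab a b f g : continuous f -> continuous g ->
  (forall x, a <= x <= b -> f x <= g x) -> intab a b f <= intab a b g.
Proof.
move=> cf cg fg; apply: le_Rintegral => //; exact: integrable_seg.
Qed.

Lemma intab_ge0 a b f : (forall x, a <= x <= b -> 0 <= f x) -> 0 <= intab a b f.
Proof. by move=> f0; apply: Rintegral_ge0 => x /=; rewrite in_itv/=; exact: f0. Qed.

Lemma eq_intab a b f g : (forall x, a <= x <= b -> f x = g x) ->
  intab a b f = intab a b g.
Proof.
by move=> fg; apply: eq_Rintegral => x; rewrite inE/= in_itv/=; exact: fg.
Qed.

Lemma intab_cat a b c f : continuous f -> a <= b -> b <= c ->
  intab a c f = intab a b f + intab b c f.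
Proof.
move=> cf ab bc; apply/eqP; rewrite addrC -subr_eq; apply/eqP.
rewrite /intab (@Rintegral_itvB _ f (BLeft a) (BRight c) b) ?bnd_simp//.
  apply: Rintegral_itv_obnd_cbnd; apply: integrableS (integrable_seg b c cf) => //.
  exact: subset_itv_oc_cc.
exact: integrable_seg.
Qed.

Lemma intab_pt a f : intab a a f = 0.
Proof. by rewrite /intab set_itv1 Rintegral_set1. Qed.

Lemma intab_FTC a b (F f : R -> R) : a <= b -> continuous f ->
  (forall x : R, is_derive x (1 : R) F (f x)) -> intab a b f = F b - F a.
Proof.
rewrite le_eqVlt => /predU1P[-> _ _|ab cf dF].
  by rewrite subrr intab_pt.
have cF : continuous F.
  by move=> x; apply/differentiable_continuous/derivable1_diffP; case: (dF x).
suff : (intab a b f)%:E = (F b - F a)%:E by case.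
rewrite -intabE// (@continuous_FTC2 _ f F)//.
- exact: continuous_subspaceT.
- split.
  + by move=> x _; case: (dF x).
  + by apply: cvg_at_right_filter; exact: cF.
  + by apply: cvg_at_left_filter; exact: cF.
- by move=> x _; rewrite derive1E; case: (dF x).
Qed.

Lemma continuous_sqrB c : continuous (fun x : R => (x - c) ^+ 2).
Proof.
move=> x; apply: (@cvg_comp _ _ _ (fun x : R => x - c) (fun y => y ^+ 2)); last first.
  exact: exprn_continuous.
by apply: cvgB; [exact: cvg_id|exact: cvg_cst].
Qed.

Lemma intab_sqrB a b c : a <= b ->
  intab a b (fun x => (x - c) ^+ 2) = ((b - c) ^+ 3 - (a - c) ^+ 3) / 3.
Proof.
move=> ab; apply: (etrans (@intab_FTC a b (fun x => 3^-1 * (x - c) ^+ 3) _ ab _ _)).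
- exact: continuous_sqrB.
- move=> x; apply: is_derive_eq => /=.
  rewrite /GRing.scale/= subr0 -mulr_natr; by field.
- by field.
Qed.

Lemma intab_cst a b k : a <= b -> intab a b (fun=> k) = k * (b - a).
Proof.
move=> ab; apply: (etrans (@intab_FTC a b (fun x => k * x) _ ab _ _)).
- exact: cst_continuous.
- by move=> x; apply: is_derive_eq; rewrite /GRing.scale/=; ring.
- by ring.
Qed.

Lemma intab_affine a b k d f : continuous f -> a <= b -> 0 < k ->
  intab (k * a + d) (k * b + d) f = k * intab a b (fun x => f (k * x + d)).
Proof.
move=> cf ab k0; pose F (x : R) : R := k * x + d.
have cFk : continuous F.
  move=> x; apply: cvgD; last exact: cvg_cst.
  by apply: cvgM; [exact: cvg_cst|exact: cvg_id].
have dF (x : R) : is_derive x (1 : R) F k.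
  by apply: is_derive_eq; rewrite /GRing.scale/= addr0; ring.
have F'E : derive1 F = cst k.
  by apply/funext => x; rewrite derive1E; case: (dF x).
have cfF : continuous (fun x => f (k * x + d)).
  by move=> x; apply: (@cvg_comp _ _ _ F f); [exact: cFk|exact: cf].
rewrite -intabZ//.
suff : (intab (F a) (F b) f)%:E = (intab a b (fun x => k * f (k * x + d)))%:E by case.
rewrite -!intabE//; last first.
  by move=> x; apply: cvgM; [exact: cvg_cst|exact: cfF].
rewrite (@integration_by_substitution_increasing _ F f a b)//.
- by apply: eq_integral => x _; rewrite F'E /= mulrC.
- by move=> x y _ _ xy; rewrite /F ltrD2r ltr_pM2l.
- by rewrite F'E => x _; exact: cst_continuous.
- by rewrite F'E; exact: is_cvg_cst.
- by rewrite F'E; exact: is_cvg_cst.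
- split.
  + by move=> x _; case: (dF x).
  + by apply: cvg_at_right_filter; exact: cFk.
  + by apply: cvg_at_left_filter; exact: cFk.
- exact: continuous_subspaceT.
Qed.

End SegmentIntegral.

(** * Integration against the density *)

Section Expectation.
Variable R : realType.
Implicit Types (x c k : R) (f g : R -> R) (m n : nat).
Local Notation mu := (@lebesgue_measure R).

Lemma inJ_bounds m x : inJ m.+1 x = (1 - (3 ^+ m)^-1 <= x <= 1 - 2 / 3 ^+ m.+1).
Proof. by []. Qed.

Lemma inJ_itv m : [set x : R | inJ m.+1 x] =
  `[1 - (3 ^+ m)^-1, 1 - 2 / 3 ^+ m.+1]%classic.
Proof. by apply/seteqP; split=> x /=; rewrite in_itv/=. Qed.

Lemma inJ_inj m n x : inJ m.+1 x -> inJ n.+1 x -> m = n.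
Proof.
wlog mn : m n / (m <= n)%N => [wlg mx nx|].
  by case/orP: (leq_total m n) => ?; [|apply/esym]; exact: wlg.
move: mn; rewrite leq_eqVlt => /predU1P[//|mn].
rewrite !inJ_bounds => /andP[_ xm] /andP[nx _].
have : (3 ^+ n : R)^-1 <= (3 ^+ m.+1)^-1.
  by rewrite lef_pV2 ?posrE ?exprn_gt0// ler_weXn2l// ler1n.
have : 0 < (3 ^+ m.+1 : R)^-1 by rewrite invr_gt0 exprn_gt0.
by move=> p0 p1; exfalso; lra.
Qed.

Lemma dens_inJ m x : inJ m.+1 x -> dens x = (3 / 2) ^+ m.+1.
Proof.
move=> mx; rewrite /dens; case: pselect => [h|]; last first.
  by case; exists m.+1.
by case: (cid h) => -[|n] [//= _ nx]; rewrite (inJ_inj mx nx).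
Qed.

Lemma dens_notinJ x : ~ (exists m, inJ m.+1 x) -> dens x = 0.
Proof.
move=> nx; rewrite /dens; case: pselect => // h; exfalso.
by case: h => -[|m] [//= _ mx]; case: nx; exists m.
Qed.

(** The index is shifted by one: [wJ m f] is the share of the expectation of [f] carried by
    $J_{m+1}$, an interval of mass [1 / 2 ^ m.+1]. *)
Definition wJ m f : R :=
  (3 / 2) ^+ m.+1 * intab (1 - (3 ^+ m)^-1) (1 - 2 / 3 ^+ m.+1) f.

Lemma le_bounds_J m : 1 - (3 ^+ m)^-1 <= 1 - 2 / 3 ^+ m.+1 :> R.
Proof.
rewrite exprS invfM.
have : 0 < (3 ^+ m : R)^-1 by rewrite invr_gt0 exprn_gt0.
lra.
Qed.

Lemma inJ_sub01 m x : inJ m.+1 x -> 0 <= x <= 1.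
Proof.
rewrite inJ_bounds => /andP[h1 h2].
have : (3 ^+ m : R)^-1 <= 1 by rewrite invf_le1 ?exprn_gt0// exprn_ege1// ler1n.
have : 0 < (3 ^+ m.+1 : R)^-1 by rewrite invr_gt0 exprn_gt0.
lra.
Qed.

Lemma wJ_ge0 m f : (forall x, 0 <= f x) -> 0 <= wJ m f.
Proof.
move=> f0; rewrite mulr_ge0 ?exprn_ge0 ?divr_ge0//.
by apply: intab_ge0 => x _; exact: f0.
Qed.

Lemma le_wJ m f g : continuous f -> continuous g ->
  (forall x, 0 <= x <= 1 -> f x <= g x) -> wJ m f <= wJ m g.
Proof.
move=> cf cg fg; rewrite ler_wpM2l ?exprn_ge0 ?divr_ge0//.
by apply: le_intab => // x /inJ_sub01; exact: fg.
Qed.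

(** The contraction [x / 3 + 2 / 3] carries $J_{m+1}$ onto $J_{m+2}$; the density grows by 3/2 and
    lengths shrink by 3, which leaves the factor 1/2. *)
Lemma wJS m f : continuous f ->
  wJ m.+1 f = 2^-1 * wJ m (fun x => f (3^-1 * x + 2 / 3)).
Proof.
move=> cf; rewrite /wJ.
have n0 : (3 ^+ m : R) != 0 by rewrite expf_neq0.
rewrite (_ : 1 - (3 ^+ m.+1)^-1 = 3^-1 * (1 - (3 ^+ m)^-1) + 2 / 3 :> R); last first.
  by rewrite exprS; field.
rewrite (_ : 1 - 2 / 3 ^+ m.+2 = 3^-1 * (1 - 2 / 3 ^+ m.+1) + 2 / 3 :> R); last first.
  by rewrite !exprS; field.
rewrite intab_affine ?le_bounds_J ?invr_gt0// exprS.
by field.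
Qed.

Lemma wJ_cst m k : wJ m (fun=> k) = k / (2 ^ m.+1)%:R.
Proof.
rewrite /wJ intab_cst ?le_bounds_J// natrX expr_div_n exprS.
have n0 : (3 ^+ m : R) != 0 by rewrite expf_neq0.
have n2 : (2 ^+ m.+1 : R) != 0 by rewrite expf_neq0.
by field; rewrite n0 n2.
Qed.

Definition meanP f : \bar R := (\sum_(0 <= m <oo) (wJ m f)%:E)%E.

Local Open Scope ereal_scope.

Lemma meanP_ge0 f : (forall x, 0 <= f x)%R -> 0 <= meanP f.
Proof. by move=> f0; apply: nneseries_ge0 => m _ _; rewrite lee_fin wJ_ge0. Qed.

Lemma le_meanP f g : continuous f -> continuous g -> (forall x, 0 <= f x)%R ->
  (forall x, 0 <= x <= 1 -> f x <= g x)%R -> meanP f <= meanP g.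
Proof.
move=> cf cg f0 fg; apply: lee_nneseries => m _.
  by move=> _; rewrite lee_fin wJ_ge0.
by rewrite lee_fin le_wJ.
Qed.

Lemma meanP_rec f : continuous f -> (forall x, 0 <= f x)%R ->
  meanP f = (wJ 0 f)%:E + (2^-1)%:E * meanP (fun x => f (3^-1 * x + 2 / 3)%R).
Proof.
move=> cf f0; rewrite /meanP nneseries_recl//; last first.
  by move=> m _; rewrite lee_fin wJ_ge0.
congr (_ + _); rewrite -nneseriesZl; last first.
  by move=> m _; rewrite lee_fin wJ_ge0.
rewrite -(nneseries_addn 1); last first.
  by move=> m; rewrite lee_fin wJ_ge0.
by apply: eq_eseriesr => m _; rewrite addn1 wJS// EFinM.
Qed.

Lemma meanPD f g : continuous f -> continuous g ->
  (forall x, 0 <= f x)%R -> (forall x, 0 <= g x)%R ->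
  meanP (fun x => f x + g x)%R = meanP f + meanP g.
Proof.
move=> cf cg f0 g0; rewrite /meanP -nneseriesD; last 2 first.
  by move=> m _ _; rewrite lee_fin wJ_ge0.
  by move=> m _ _; rewrite lee_fin wJ_ge0.
by apply: eq_eseriesr => m _; rewrite /wJ intabD// mulrDr.
Qed.

Lemma meanPZ k f : continuous f -> (forall x, 0 <= f x)%R ->
  meanP (fun x => k * f x)%R = k%:E * meanP f.
Proof.
move=> cf f0; rewrite /meanP -nneseriesZl; last first.
  by move=> m _; rewrite lee_fin wJ_ge0.
by apply: eq_eseriesr => m _; rewrite /wJ intabZ// mulrCA.
Qed.

Lemma meanP_fin f : continuous f -> (forall x, 0 <= f x)%R ->
  (exists M, forall x, 0 <= x <= 1 -> f x <= M)%R -> meanP f \is a fin_num.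
Proof.
move=> cf f0 [M fM]; rewrite ge0_fin_numE ?meanP_ge0//.
have M0 : (0 <= M)%R by apply: le_trans (f0 0%R) (fM _ _); rewrite lexx ler01.
apply: le_lt_trans (ltry M).
(* The masses [1 / 2 ^ m.+1] sum to at most 1. *)
apply: le_trans (epsilon_trick0 xpredT M0); apply: lee_nneseries => m _.
  by move=> _; rewrite lee_fin wJ_ge0.
by rewrite lee_fin -wJ_cst le_wJ//; exact: cst_continuous.
Qed.

Lemma integral_dens f : continuous f -> (forall x, 0 <= f x)%R ->
  \int[mu]_x ((dens x)%:E * (f x)%:E) = meanP f.
Proof.
move=> cf f0.
pose J m := [set x : R | inJ m.+1 x].
have mJ m : measurable (J m) by rewrite /J inJ_itv; exact: measurable_itv.
have dJ m : {in J m, (fun x => (dens x)%:E * (f x)%:E)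
     =1 fun x => ((3 / 2) ^+ m.+1)%:E * (f x)%:E}.
  by move=> x; rewrite inE /= => /dens_inJ ->.
have mf : measurable_fun [set: R] (EFin \o f).
  by apply/measurable_EFinP; exact: continuous_measurable_fun.
have -> : \int[mu]_x ((dens x)%:E * (f x)%:E) =
    \int[mu]_(x in \bigcup_m J m) ((dens x)%:E * (f x)%:E).
  rewrite [RHS]integral_mkcond; apply: eq_integral => x _.
  rewrite patchE; case: ifPn => // /negP xJ.
  rewrite dens_notinJ ?mul0e// => -[m mx]; apply: xJ; rewrite inE.
  by exists m.
rewrite ge0_integral_bigcup//; last 3 first.
- apply/measurable_fun_bigcup => // m.
  apply: (eq_measurable_fun (fun x => ((3 / 2) ^+ m.+1)%:E * (f x)%:E)).
    by move=> x /dJ ->.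
  by apply: measurable_funTS; exact: emeasurable_funM.
- move=> x [m _ mx]; rewrite (dens_inJ mx); apply: mule_ge0; rewrite lee_fin//.
- by apply/trivIsetP => m n _ _ mn; rewrite -subset0 => x [mx nx];
    move/eqP: mn; apply; exact: inJ_inj mx nx.
rewrite /meanP; apply: eq_eseriesr => m _.
transitivity (\int[mu]_(x in J m) (((3 / 2) ^+ m.+1)%:E * (f x)%:E)).
  by apply: eq_integral => x /dJ.
rewrite ge0_integralZl//=; last 3 first.
- exact: mJ.
- exact: measurable_funTS.
- by move=> x _; rewrite lee_fin.
by rewrite /J inJ_itv intabE// -EFinM.
Qed.

End Expectation.

(** * Squared distance to a finite set *)

Section Distortion.
Variable R : realType.
Implicit Types (x c h k : R) (b s : seq R) (m n : nat).

(** The default repeats the head, so it does not disturb the minimum over a nonempty list. On the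
    empty list the value is [x ^+ 2] instead of infinity; that case is handled by
    [distortion_nil]. *)
Definition sqd b x : R := \big[Num.min/(x - head 0 b) ^+ 2]_(c <- b) (x - c) ^+ 2.

Lemma sqd_le b c x : c \in b -> sqd b x <= (x - c) ^+ 2.
Proof.
rewrite /sqd; elim: b (head 0 b) => [//|d b IH] e; rewrite inE big_cons ge_min.
by case/predU1P => [->|/IH ->]; rewrite ?lexx ?orbT.
Qed.

Lemma sqd_attained b x : b != [::] -> exists2 c, c \in b & sqd b x = (x - c) ^+ 2.
Proof.
case: b => // d b _; rewrite /sqd /=.
suff : forall s, \big[Num.min/(x - d) ^+ 2]_(c <- s) (x - c) ^+ 2 = (x - d) ^+ 2 \/
    exists2 c, c \in s & \big[Num.min/(x - d) ^+ 2]_(c <- s) (x - c) ^+ 2 = (x - c) ^+ 2.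
  by case/(_ (d :: b)) => [->|//]; exists d; rewrite ?mem_head.
elim => [|e s IH]; first by rewrite big_nil; left.
rewrite big_cons minEle; case: ifP => _.
  by right; exists e; rewrite ?mem_head.
case: IH => [->|[c cs ->]]; first by left.
by right; exists c; rewrite // inE cs orbT.
Qed.

(** Every trade of points below is justified by this pointwise comparison, applied for all [x] in
    the region concerned. *)
Lemma sqd_dom b s x : s != [::] ->
  (forall c, c \in s -> exists2 d, d \in b & (x - d) ^+ 2 <= (x - c) ^+ 2) ->
  sqd b x <= sqd s x.
Proof.
move=> s0 h; have [c cs ->] := sqd_attained x s0.
by have [d db] := h c cs; apply: le_trans; exact: sqd_le.
Qed.

Lemma sqd_ge0 b x : 0 <= sqd b x.
Proof.
rewrite /sqd; apply: (big_ind (fun y => 0 <= y)) => [|y z y0 z0|c _]; rewrite ?sqr_ge0//.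
by rewrite le_min y0 z0.
Qed.

Lemma sqd_continuous b : continuous (sqd b).
Proof.
rewrite /sqd; elim: b (head 0 b) => [|d b IH] e.
  rewrite [X in continuous X](_ : _ = fun x => (x - e) ^+ 2); last first.
    by apply/funext => x; rewrite big_nil.
  exact: continuous_sqrB.
rewrite [X in continuous X](_ : _ = fun x =>
    Num.min ((x - d) ^+ 2) (\big[Num.min/(x - e) ^+ 2]_(c <- b) (x - c) ^+ 2)); last first.
  by apply/funext => x; rewrite big_cons.
move=> x; apply: (@continuous_min _ _ (fun x => (x - d) ^+ 2) _ x).
  exact: continuous_sqrB.
exact: IH.
Qed.

Lemma sqd_ereal b x : b != [::] ->
  (\big[Order.min/+oo]_(c <- b) ((x - c) ^+ 2)%:E = (sqd b x)%:E)%E.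
Proof.
move=> b0; apply/eqP; rewrite eq_le; apply/andP; split.
  have [c cb ->] := sqd_attained x b0.
  elim: b cb {b0} => // d b IH; rewrite inE big_cons ge_min.
  by case/predU1P => [->|/IH ->]; rewrite ?lexx ?orbT.
have : forall c, c \in b -> sqd b x <= (x - c) ^+ 2 by move=> c; exact: sqd_le.
move: (sqd b x) => v; elim: b {b0} => [_|d s IH h]; first by rewrite big_nil leey.
rewrite big_cons le_min lee_fin h ?mem_head//=; apply: IH => c cs.
by apply: h; rewrite inE cs orbT.
Qed.

Definition pull c : R := 3 * c - 2.

Lemma sqd_pull b x : b != [::] ->
  sqd b (3^-1 * x + 2 / 3) = 9^-1 * sqd (map pull b) x.
Proof.
move=> b0; have b0' : map pull b != [::] by case: b b0.
have sc c : (3^-1 * x + 2 / 3 - c) ^+ 2 = 9^-1 * (x - pull c) ^+ 2.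
  by rewrite /pull; field.
apply/eqP; rewrite eq_le; apply/andP; split.
  have [_ /mapP[c cb ->] ->] := sqd_attained x b0'.
  by rewrite -sc sqd_le.
have [c cb ->] := sqd_attained (3^-1 * x + 2 / 3) b0.
by rewrite sc ler_wpM2l ?invr_ge0// sqd_le ?map_f.
Qed.

Definition dist b : R := fine (meanP (sqd b)).

Lemma meanP_sqd b : meanP (sqd b) = (dist b)%:E.
Proof.
rewrite /dist fineK//; apply: meanP_fin.
- exact: sqd_continuous.
- by move=> x; exact: sqd_ge0.
exists ((1 + `|head 0 b|) ^+ 2) => x /andP[x0 x1].
apply: (@le_trans _ _ ((x - head 0 b) ^+ 2)).
  case: b => [|c b]; first by rewrite /sqd big_nil.
  by rewrite sqd_le ?mem_head.
rewrite -(real_normK (num_real _)) ler_pXn2r ?nnegrE ?addr_ge0//.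
by rewrite (le_trans (ler_normB _ _))// lerD2r ger0_norm.
Qed.

Lemma distortionE b : b != [::] -> distortion b = (dist b)%:E.
Proof.
move=> b0; rewrite -meanP_sqd -integral_dens; last 2 first.
- exact: sqd_continuous.
- by move=> x; exact: sqd_ge0.
by apply: eq_integral => x _; rewrite sqd_ereal.
Qed.

Lemma dist_ge0 b : 0 <= dist b.
Proof. by rewrite fine_ge0// meanP_ge0// => x; exact: sqd_ge0. Qed.

Lemma le_dist b s : (forall x, 0 <= x <= 1 -> sqd b x <= sqd s x) ->
  dist b <= dist s.
Proof.
move=> h; rewrite -lee_fin -!meanP_sqd; apply: le_meanP => //.
- exact: sqd_continuous.
- exact: sqd_continuous.
- by move=> x; exact: sqd_ge0.
Qed.

Definition cost b : R := 3 / 2 * intab 0 (1 / 3) (sqd b).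

Lemma wJ0 f : wJ 0 f = 3 / 2 * intab (0 : R) (1 / 3) f.
Proof.
rewrite /wJ !expr1 expr0 invr1 subrr (_ : 1 - 2 / 3 = 1 / 3 :> R)//.
by field.
Qed.

Lemma le_cost b s : (forall x, 0 <= x <= 1 / 3 -> sqd b x <= sqd s x) ->
  cost b <= cost s.
Proof.
move=> h; rewrite ler_wpM2l ?divr_ge0//.
by apply: le_intab => //; exact: sqd_continuous.
Qed.

(** The factor 18 is 2 times 9: the copy of the measure on [[2/3, 1]] carries half of the mass, and
    squared distances shrink there by 9. *)
Lemma dist_rec b : b != [::] -> dist b = cost b + dist (map pull b) / 18.
Proof.
move=> b0; suff : (dist b)%:E = (cost b + dist (map pull b) / 18)%:E by case.
rewrite -meanP_sqd meanP_rec; last 2 first.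
- exact: sqd_continuous.
- by move=> x; exact: sqd_ge0.
rewrite (_ : (fun x => _) = (fun x => 9^-1 * sqd (map pull b) x)); last first.
  by apply/funext => x; rewrite sqd_pull.
rewrite meanPZ; last 2 first.
- exact: sqd_continuous.
- by move=> x; exact: sqd_ge0.
rewrite meanP_sqd wJ0 -!EFinM -EFinD; congr (_ + _)%:E.
by field.
Qed.

Lemma sqd1 c x : sqd [:: c] x = (x - c) ^+ 2.
Proof. by rewrite /sqd big_cons big_nil minxx. Qed.

Lemma cost1 c : cost [:: c] = 1 / 216 + (c - 1 / 6) ^+ 2 / 2.
Proof.
rewrite /cost (_ : sqd [:: c] = fun x => (x - c) ^+ 2); last first.
  by apply/funext => x; rewrite sqd1.
by rewrite intab_sqrB; [field|lra].
Qed.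

(** Self-similarity gives t = 1/2 + t/2 for the total mass t, which forces t = 1 once t is known to
    be finite. *)
Lemma meanP1 : meanP (fun=> 1 : R) = 1%E.
Proof.
have fin : meanP (fun=> 1 : R) \is a fin_num.
  apply: meanP_fin; [exact: cst_continuous|by []|].
  by exists 1.
have := @meanP_rec R (fun=> 1) (@cst_continuous _ _ _) (fun=> ler01).
rewrite -(fineK fin) wJ_cst -!EFinM -EFinD => -[].
by move=> e; congr EFin; lra.
Qed.

(* As 1 is the fixed point of pull, c = pull c / 3 + 2 / 3 * 1; this convexity
   relation and dist_rec together determine dist [:: c]. *)
Lemma dist1_line c :
  dist [:: c] + 2 * (1 - c) ^+ 2 = dist [:: pull c] / 3 + 2 / 3 * dist [:: 1].
Proof.
suff : (dist [:: c] + 2 * (1 - c) ^+ 2)%:E =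
  (3^-1 * dist [:: pull c] + 2 / 3 * dist [:: 1])%:E by case=> ->; ring.
have cs d : continuous (sqd [:: d]) by exact: sqd_continuous.
have cM k d : continuous (fun x => k * sqd [:: d] x).
  by move=> x; apply: cvgM; [exact: cvg_cst|exact: cs].
have M0 k d : 0 <= k -> forall x, 0 <= k * sqd [:: d] x.
  by move=> k0 x; rewrite mulr_ge0 ?sqd_ge0.
transitivity (meanP (fun x => sqd [:: c] x + 2 * (1 - c) ^+ 2 * 1)).
  rewrite meanPD//; last 3 first.
  - exact: cst_continuous.
  - by move=> x; exact: sqd_ge0.
  - by move=> x; rewrite mulr1 mulr_ge0 ?sqr_ge0.
  rewrite meanPZ//; last exact: cst_continuous.
  by rewrite meanP1 mule1 meanP_sqd -EFinD.
rewrite (_ : (fun x => _) =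
  fun x => 3^-1 * sqd [:: pull c] x + 2 / 3 * sqd [:: 1] x); last first.
  by apply/funext => x; rewrite !sqd1 /pull; field.
rewrite meanPD//; last 2 first.
- by apply: M0; lra.
- by apply: M0; lra.
rewrite !meanPZ//; try by move=> x; exact: sqd_ge0.
by rewrite !meanP_sqd.
Qed.

(** The constants are the variance and the mean of $P$. Eliminating [dist [:: pull c]] between
    [dist1_line] and [dist_rec] yields them without computing moments. *)
Lemma dist1 c : dist [:: c] = 25 / 204 + (c - 1 / 2) ^+ 2.
Proof.
(* As [pull] fixes 1, [dist_rec] becomes a linear equation for this value. *)
have e1 : dist [:: 1] = 76 / 204.
  have := @dist_rec [:: 1] isT; rewrite cost1 /= /pull.
  rewrite (_ : 3 * 1 - 2 = 1); last by ring.
  by move=> e; lra.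
have := dist1_line c; have := @dist_rec [:: c] isT.
by rewrite cost1 e1 /= => ea eb; lra.
Qed.

(** * Parabolic bumps around the points *)

Definition hat h c x : R := Num.max 0 (h ^+ 2 - (x - c) ^+ 2).

Lemma hat_continuous h c : continuous (hat h c).
Proof.
move=> x; apply: (@continuous_max _ _ (fun=> 0)
  (fun x => h ^+ 2 - (x - c) ^+ 2) x); first exact: cvg_cst.
by apply: cvgB; [exact: cvg_cst|exact: continuous_sqrB].
Qed.

Lemma hat_ge0 h c x : 0 <= hat h c x.
Proof. by rewrite le_max lexx. Qed.

Lemma hat_out h c x : 0 <= h -> h <= `|x - c| -> hat h c x = 0.
Proof.
move=> h0 hx; apply/max_idPl; rewrite subr_le0 -[leRHS]real_normK ?num_real//.
by rewrite ler_pXn2r ?nnegrE.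
Qed.

Lemma hat_in h c x : 0 <= h -> `|x - c| <= h -> hat h c x = h ^+ 2 - (x - c) ^+ 2.
Proof.
move=> h0 hx; apply/max_idPr; rewrite subr_ge0 -[leLHS]real_normK ?num_real//.
by rewrite ler_pXn2r ?nnegrE.
Qed.

Lemma intab_hat_in h c u v : 0 <= h -> c - h <= u -> u <= v -> v <= c + h ->
  intab u v (hat h c) = h ^+ 2 * (v - u) - ((v - c) ^+ 3 - (u - c) ^+ 3) / 3.
Proof.
move=> h0 cu uv vc.
rewrite (@eq_intab _ _ _ _ (fun x => h ^+ 2 + (-1) * (x - c) ^+ 2)); last first.
  move=> x /andP[ux xv]; rewrite hat_in//; first by ring.
  by rewrite ler_norml; lra.
rewrite intabD; [|exact: cst_continuous|].
  rewrite intab_cst// (@intabZ _ _ _ (-1) (fun x => (x - c) ^+ 2)); last first.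
    exact: continuous_sqrB.
  by rewrite intab_sqrB//; field.
move=> x; apply: (@cvgM _ _ _ _ (fun=> -1) (fun x => (x - c) ^+ 2)).
  exact: cvg_cst.
exact: continuous_sqrB.
Qed.

Lemma intab_hat_out h c u v : 0 <= h -> u <= v -> v <= c - h \/ c + h <= u ->
  intab u v (hat h c) = 0.
Proof.
move=> h0 uv out; rewrite (@eq_intab _ _ _ _ (fun=> 0)); last first.
  move=> x /andP[ux xv]; rewrite hat_out////.
  by case: out => ?; rewrite ler_normr; apply/orP; [right|left]; lra.
by rewrite intab_cst// mul0r.
Qed.
End Distortion.

(** * The uniform part *)

Section UniformCost.
Variable R : realType.
Implicit Types (x c h u v : R) (b s : seq R) (n : nat).

Lemma intab_hat_right h c v : 0 <= h -> c + h <= v ->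
  intab c v (hat h c) = 2 / 3 * h ^+ 3.
Proof.
move=> h0 hv; rewrite (@intab_cat _ c (c + h)); [|exact: hat_continuous|lra|lra].
rewrite intab_hat_in; [|lra..].
by rewrite intab_hat_out; [field|lra|lra|right; lra].
Qed.

Lemma intab_hat_left h c u : 0 <= h -> u <= c - h ->
  intab u c (hat h c) = 2 / 3 * h ^+ 3.
Proof.
move=> h0 hu; rewrite (@intab_cat _ u (c - h)); [|exact: hat_continuous|lra|lra].
rewrite intab_hat_out; [|lra|lra|by left].
by rewrite intab_hat_in; [field|lra..].
Qed.

Lemma le_intab_hat h c (u v u' v' : R) : u' <= u -> u <= v -> v <= v' ->
  intab u v (hat h c) <= intab u' v' (hat h c).
Proof.
move=> u'u uv vv'; have ch := @hat_continuous R h c.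
have ge0 w z : 0 <= intab w z (hat h c) by apply: intab_ge0 => x _; exact: hat_ge0.
rewrite (@intab_cat _ u' u v')//; last lra.
rewrite (@intab_cat _ u v v')//.
by have := ge0 u' u; have := ge0 v v'; lra.
Qed.

Lemma intab_hat_le h c u v : 0 <= h -> u <= v ->
  intab u v (hat h c) <= 4 / 3 * h ^+ 3.
Proof.
(* Enlarging the segment until it contains the support of the bump makes the integral explicit. *)
move=> h0 uv; pose u' := Num.min u (c - h); pose v' := Num.max v (c + h).
have u'1 : u' <= u by rewrite ge_min lexx.
have u'2 : u' <= c - h by rewrite ge_min lexx orbT.
have v'1 : v <= v' by rewrite le_max lexx.
have v'2 : c + h <= v' by rewrite le_max lexx orbT.
apply: (le_trans (le_intab_hat _ _ u'1 uv v'1)).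
rewrite (@intab_cat _ u' c v'); [|exact: hat_continuous|lra|lra].
by rewrite intab_hat_left// intab_hat_right//; lra.
Qed.

Lemma intab_hat_le_out h c u v : 0 <= h -> u <= v -> c <= u \/ v <= c ->
  intab u v (hat h c) <= 2 / 3 * h ^+ 3.
Proof.
move=> h0 uv [cu|vc].
  pose v' := Num.max v (c + h).
  have v'1 : v <= v' by rewrite le_max lexx.
  have v'2 : c + h <= v' by rewrite le_max lexx orbT.
  by apply: (le_trans (le_intab_hat _ _ cu uv v'1)); rewrite intab_hat_right.
pose u' := Num.min u (c - h).
have u'1 : u' <= u by rewrite ge_min lexx.
have u'2 : u' <= c - h by rewrite ge_min lexx orbT.
by apply: (le_trans (le_intab_hat _ _ u'1 uv vc)); rewrite intab_hat_left.
Qed.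

Lemma sqd_hat h b x : b != [::] ->
  h ^+ 2 <= sqd b x + \sum_(c <- b) hat h c x.
Proof.
move=> b0; have [c cb ->] := sqd_attained x b0.
have le1 : hat h c x <= \sum_(c <- b) hat h c x.
  rewrite (big_rem c)//= lerDl; apply: sumr_ge0 => d _; exact: hat_ge0.
have le2 : h ^+ 2 - (x - c) ^+ 2 <= hat h c x by rewrite le_max lexx orbT.
lra.
Qed.

Lemma intab_sum_hat h b u v : u <= v ->
  continuous (fun x => \sum_(c <- b) hat h c x) /\
  intab u v (fun x => \sum_(c <- b) hat h c x) =
  \sum_(c <- b) intab u v (hat h c).
Proof.
move=> uv; elim: b => [|c b [cb IH]].
  rewrite (_ : (fun x => _) = (fun=> 0)); last by apply/funext => x; rewrite big_nil.
  by rewrite intab_cst// mul0r big_nil; split => //; exact: cst_continuous.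
rewrite (_ : (fun x => _) = (fun x => hat h c x + \sum_(c <- b) hat h c x)); last first.
  by apply/funext => x; rewrite big_cons.
split; first by move=> x; apply: cvgD; [exact: hat_continuous|exact: cb].
by rewrite intabD// ?IH ?big_cons//; exact: hat_continuous.
Qed.

(** [sqd_hat] is integrated against the density 3/2; the left side is [h ^+ 2] times the mass 1/2 of
    $J_1$. The radius stays free, to be fitted to the number of points. *)
Lemma cost_hat h b : b != [::] ->
  h ^+ 2 / 2 <= cost b + 3 / 2 * \sum_(c <- b) intab 0 (1 / 3) (hat h c).
Proof.
move=> b0; have L : 0 <= 1 / 3 :> R by lra.
have [cs <-] := intab_sum_hat h b L.
rewrite /cost -mulrDr -intabD//; last exact: sqd_continuous.
rewrite (_ : h ^+ 2 / 2 = 3 / 2 * intab 0 (1 / 3) (fun=> h ^+ 2)); last first.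
  by rewrite intab_cst//; field.
rewrite ler_wpM2l ?divr_ge0//; apply: le_intab => [||x _]; last exact: sqd_hat.
- exact: cst_continuous.
- by move=> x; apply: cvgD; [exact: sqd_continuous|exact: cs].
Qed.

Lemma sum_seq_le (b : seq R) (F : R -> R) K : (forall c, F c <= K) ->
  \sum_(c <- b) F c <= (size b)%:R * K.
Proof.
move=> FK; elim: b => [|c b IH]; first by rewrite big_nil mul0r.
by rewrite big_cons /= -natr1; have := FK c; lra.
Qed.

Lemma cost_ge b : b != [::] -> (216 * (size b)%:R ^+ 2)^-1 <= cost b.
Proof.
move=> b0; set n : R := (size b)%:R.
have n0 : 0 < n by rewrite ltr0n lt0n size_eq0.
(* This radius maximizes the resulting bound [h ^+ 2 / 2 - 2 * n * h ^+ 3]; it is half of a cell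
   when $J_1$ is cut into [n] equal cells. *)
pose h := (6 * n)^-1; have h0 : 0 <= h by rewrite invr_ge0; lra.
have := cost_hat h b0.
have : \sum_(c <- b) intab 0 (1 / 3) (hat h c) <= n * (4 / 3 * h ^+ 3).
  by apply: sum_seq_le => c; apply: intab_hat_le => //; lra.
have -> : n * (4 / 3 * h ^+ 3) = 2 / 9 * h ^+ 2 by rewrite /h; field; lra.
have -> : (216 * n ^+ 2)^-1 = h ^+ 2 / 6 by rewrite /h; field; lra.
lra.
Qed.

(* A point outside the interior of the segment covers it from one side only,
   so it counts for half a point. *)
Lemma cost_ge_out b c : c \in b -> c <= 0 \/ 1 / 3 <= c ->
  (216 * ((size b)%:R - 1 / 2) ^+ 2)^-1 <= cost b.
Proof.
move=> cb oc; have b0 : b != [::] by apply: contraTneq cb => ->.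
set n : R := (size b)%:R.
have n1 : 1 <= n by rewrite ler1n lt0n size_eq0.
(* The optimal radius for an effective number [n - 1 / 2] of points. *)
pose h := (6 * (n - 1 / 2))^-1; have h0 : 0 <= h by rewrite invr_ge0; lra.
have := cost_hat h b0.
have : \sum_(c <- b) intab 0 (1 / 3) (hat h c) <=
    2 / 3 * h ^+ 3 + (n - 1) * (4 / 3 * h ^+ 3).
  rewrite (big_rem c)//=; apply: lerD; first by apply: intab_hat_le_out => //; lra.
  rewrite (_ : n - 1 = (size (rem c b))%:R).
    by apply: sum_seq_le => d; apply: intab_hat_le => //; lra.
  by rewrite size_rem// /n -subn1 natrB// lt0n size_eq0.
have -> : 2 / 3 * h ^+ 3 + (n - 1) * (4 / 3 * h ^+ 3) = 2 / 9 * h ^+ 2.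
  by rewrite /h; field; lra.
have -> : (216 * (n - 1 / 2) ^+ 2)^-1 = h ^+ 2 / 6 by rewrite /h; field; lra.
lra.
Qed.

Lemma cost_gt_out b c : c \in b -> c <= 0 \/ 1 / 3 <= c ->
  (216 * (size b)%:R ^+ 2)^-1 < cost b.
Proof.
move=> cb oc; apply: lt_le_trans (cost_ge_out cb oc).
have n1 : 1 <= (size b)%:R :> R by rewrite ler1n lt0n size_eq0; apply: contraTneq cb => ->.
move: (size b)%:R n1 => n n1.
have ? : 0 < n - 1 / 2 by lra.
have ? : 0 < n by lra.
by rewrite ltf_pV2 ?posrE ?mulr_gt0 ?exprn_gt0// ltr_pM2l// ltr_pXn2r ?nnegrE//; lra.
Qed.

(* A point at distance at least 1/6 from the segment does not improve on the
   optimal radius 1/(6 n) <= 1/6. *)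
Lemma cost_ge_far b c : b != [::] -> 1 / 2 <= c ->
  (216 * (size b)%:R ^+ 2)^-1 <= cost (c :: b).
Proof.
move=> b0 c2; set n : R := (size b)%:R.
have n1 : 1 <= n by rewrite ler1n lt0n size_eq0.
pose h := (6 * n)^-1; have h0 : 0 <= h by rewrite invr_ge0; lra.
have h6 : h <= 1 / 6.
  by rewrite /h div1r lef_pV2 ?posrE; lra.
have := @cost_hat h (c :: b) isT; rewrite big_cons intab_hat_out; [|lra|lra|left; lra].
have : \sum_(c <- b) intab 0 (1 / 3) (hat h c) <= n * (4 / 3 * h ^+ 3).
  by apply: sum_seq_le => d; apply: intab_hat_le => //; lra.
have -> : n * (4 / 3 * h ^+ 3) = 2 / 9 * h ^+ 2 by rewrite /h; field; lra.
have -> : (216 * n ^+ 2)^-1 = h ^+ 2 / 6 by rewrite /h; field; lra.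
lra.
Qed.

Definition midpoints n : seq R :=
  [seq (2 * i%:R + 1) / (6 * n%:R) | i <- iota 0 n].

Lemma cost_midpoints n : (0 < n)%N -> cost (midpoints n) <= (216 * n%:R ^+ 2)^-1.
Proof.
move=> n0; have N0 : 0 < n%:R :> R by rewrite ltr0n.
pose d : R := (3 * n%:R)^-1; have d0 : 0 <= d by rewrite invr_ge0; lra.
(* Induction on the number of cells covered: a cell of length [d] served by its midpoint costs
   [d ^+ 3 / 12]. *)
have H k : (k <= n)%N ->
    intab 0 (k%:R * d) (sqd (midpoints n)) <= k%:R * (d ^+ 3 / 12).
  elim: k => [_|k IH kn]; first by rewrite !mul0r intab_pt.
  have ab : k%:R * d <= k.+1%:R * d by rewrite ler_wpM2r// ler_nat.
  rewrite (@intab_cat _ 0 (k%:R * d)); [|exact: sqd_continuous|exact: mulr_ge0|by []].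
  have {}IH := IH (ltnW kn).
  pose c : R := (2 * k%:R + 1) / (6 * n%:R).
  have : intab (k%:R * d) (k.+1%:R * d) (sqd (midpoints n)) <=
      intab (k%:R * d) (k.+1%:R * d) (fun x => (x - c) ^+ 2).
    apply: le_intab; [exact: sqd_continuous|exact: continuous_sqrB|] => x _.
    by apply/sqd_le/mapP; exists k; rewrite // mem_iota.
  rewrite intab_sqrB// -natr1.
  have -> : ((k%:R + 1) * d - c) = d / 2 by rewrite /c /d; field; lra.
  have -> : (k%:R * d - c) = - (d / 2) by rewrite /c /d; field; lra.
  move: IH; lra.
have := H n (leqnn n).
have -> : n%:R * d = 1 / 3 by rewrite /d; field; lra.
rewrite /cost => {}H; apply: (@le_trans _ _ (3 / 2 * (n%:R * (d ^+ 3 / 12)))).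
  by rewrite ler_wpM2l ?divr_ge0.
by rewrite le_eqVlt; apply/orP; left; apply/eqP; rewrite /d; field; lra.
Qed.

End UniformCost.

(** * Values of canonical sequences *)

Section LowerBound.
Variable R : realType.
Implicit Types (x c p v : R) (b s : seq R) (i l n N : nat) (ns : seq nat).

(** The error of the canonical sequence [ns] followed by its final 1, in the form of the recursion
    [dist_rec]. The base value is the variance, the error of one point at the mean. *)
Fixpoint Fval ns : R :=
  if ns is n :: ns' then (216 * n%:R ^+ 2)^-1 + Fval ns' / 18 else 25 / 204.

Definition posseq ns := all (fun n => 0 < n)%N ns.

(** The strict inequality on the sum leaves room for the final point. An infimum is used, so that
    lower bounds can be proved without exhibiting a minimizer. *)
Definition Wval N : R :=
  inf [set v | exists ns, [/\ posseq ns, (sumn ns < N)%N & v = Fval ns]].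

Lemma Fval_ge0 ns : 0 <= Fval ns.
Proof.
elim: ns => [|n ns IH] /=; first by lra.
by rewrite addr_ge0 ?divr_ge0// invr_ge0 mulr_ge0// exprn_ge0.
Qed.

Lemma Wval_le N ns : posseq ns -> (sumn ns < N)%N -> Wval N <= Fval ns.
Proof.
move=> pns sns; apply: ge_inf; last by exists ns.
by exists 0 => _ [ms [_ _ ->]]; exact: Fval_ge0.
Qed.

Lemma Wval_ge N v : (0 < N)%N ->
  (forall ns, posseq ns -> (sumn ns < N)%N -> v <= Fval ns) -> v <= Wval N.
Proof.
move=> N0 h; apply: lb_le_inf; first by exists (Fval [::]), [::].
by move=> _ [ns [pns sns ->]]; exact: h.
Qed.

(** Prefixing [i] to a sequence admissible for [l] points gives one admissible for [N]. *)
Lemma Wval_step N i l : (0 < i)%N -> (0 < l)%N -> (i + l <= N)%N ->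
  Wval N <= (216 * i%:R ^+ 2)^-1 + Wval l / 18.
Proof.
move=> i0 l0 il; have h : (Wval N - (216 * i%:R ^+ 2)^-1) * 18 <= Wval l.
  apply: Wval_ge => // ns pns sns.
  have : Wval N <= Fval (i :: ns).
    by apply: Wval_le => /=; [rewrite /posseq /= i0|lia].
  by move=> /=; lra.
lra.
Qed.

Lemma Wval1 N : (0 < N)%N -> Wval N <= 25 / 204.
Proof. by move=> N0; exact: (@Wval_le N [::]). Qed.

(** The value of the sequence [[:: 1]], a crude bound that already beats the sets having no point in
    [[0, 1/3]] or none in [[2/3, 1]], when the gap is empty. *)
Lemma Wval2 N : (1 < N)%N -> Wval N <= 1 / 216 + 25 / 3672.
Proof.
move=> N1; have := @Wval_le N [:: 1%N] isT N1; rewrite /= expr1n; lra.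
Qed.

(** The counting conditions of [canonical_seq_of] with 0-based columns and without the final 1. The
    empty sequence is allowed, which makes induction on [ns] possible. *)
Definition canon_counts b ns :=
  (forall j, (j < size ns)%N ->
     nth 0%N ns j = count (inJ j.+1) b /\ (0 < nth 0%N ns j)%N) /\
  count (fun x => (1 - (3 ^+ size ns)^-1 <= x) && (x <= 1)) b = 1%N.

Lemma inJ_pull j c : inJ j.+1 (pull c) = inJ j.+2 c.
Proof.
have n0 : 0 < (3 ^+ j : R)^-1 by rewrite invr_gt0 exprn_gt0.
rewrite !inJ_bounds /pull !exprS !invfM.
by apply/idP/idP => /andP[h1 h2]; apply/andP; split; lra.
Qed.

Lemma inJS_ge j c : inJ j.+2 c -> 2 / 3 <= c.
Proof.
rewrite -inJ_pull => /inJ_sub01 /andP[+ _]; rewrite /pull; lra.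
Qed.

Definition rescaled b := [seq pull c | c <- b & 2 / 3 <= c].

(** [pull] carries $J_{j+2}$ onto $J_{j+1}$ and each tail interval onto the previous one, so
    removing the first column amounts to rescaling the points from 2/3 on. *)
Lemma canon_rescaled b n ns : canon_counts b (n :: ns) ->
  n = count (inJ 1) b /\ canon_counts (rescaled b) ns.
Proof.
move=> [h t]; split; first by have [] := h 0%N isT.
split => [j js|].
  have [/= -> ?] := h j.+1 js; split=> //.
  rewrite /rescaled count_map count_filter; apply: eq_count => c /=.
  rewrite inJ_pull; case: (boolP (inJ _ _)) => // /inJS_ge ->//.
apply: etrans t; rewrite /rescaled count_map count_filter; apply: eq_count => c /=.
have n0 : 0 < (3 ^+ size ns : R)^-1 by rewrite invr_gt0 exprn_gt0.
have n1 : (3 ^+ size ns : R)^-1 <= 1.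
  by rewrite invf_le1 ?exprn_gt0// exprn_ege1// ler1n.
rewrite exprS invfM /pull.
by apply/idP/idP => [/andP[/andP[h1 h2] h3]|/andP[h1 h2]];
  rewrite -?andbA; repeat (apply/andP; split); lra.
Qed.

Lemma seq_min (s : seq R) : s != [::] -> exists2 p, p \in s & {in s, forall c, p <= c}.
Proof.
elim: s => // c [_ _|d s IH _].
  by exists c; rewrite ?mem_head// => d; rewrite inE => /eqP ->.
have [p ps pm] := IH isT; have [cp|pc] := leP c p.
  exists c; rewrite ?mem_head// => e; rewrite inE => /predU1P[->//|/pm].
  exact: le_trans.
exists p; first by rewrite inE ps orbT.
by move=> e; rewrite inE => /predU1P[->|/pm//]; exact: ltW.
Qed.

Lemma seq_max (s : seq R) : s != [::] -> exists2 p, p \in s & {in s, forall c, c <= p}.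
Proof.
move=> s0; have [|p /mapP[q qs ->] qm] := @seq_min (map -%R s); first by case: s s0.
by exists q => // c cs; rewrite -lerN2; apply: qm; rewrite map_f.
Qed.

(** The outer parts keep points below 0 and above 1; these are ruled out only in the equality case
    of [bounded_below]. *)
Definition lpart b := [seq c <- b | c <= 1 / 3].
Definition gpart b := [seq c <- b | 1 / 3 < c < 2 / 3].
Definition rpart b := [seq c <- b | 2 / 3 <= c].

Lemma size_parts b :
  (size (lpart b) + size (gpart b) + size (rpart b) = size b)%N.
Proof.
elim: b => //= c b; rewrite /lpart /gpart /rpart /=.
have [h1|h1] := leP c (1 / 3); have [h2|h2] := ltP c (2 / 3) => /=; try lia.
by exfalso; lra.
Qed.

Lemma pull_inj : injective (@pull R).
Proof. by move=> c d; rewrite /pull; lra. Qed.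

(** The induction statement carries the equality case along: the location in [[0, 1]] is what allows
    counting the points of $J_1$ and makes a rescaled gap point, which is negative, a strict
    loss. *)
Definition bounded_below b := Wval (size b) <= dist b /\
  (dist b <= Wval (size b) -> (forall c, c \in b -> 0 <= c <= 1) /\
     forall ns, canon_counts b ns -> Fval ns <= dist b).

Lemma bounded_below_gt b : Wval (size b) < dist b -> bounded_below b.
Proof. by move=> h; split; [exact: ltW|rewrite leNgt h]. Qed.

(** The threshold is the cost of a single point at either end of $J_1$. *)
Lemma dist_gt_left b : (1 < size b)%N -> 4 / 216 <= cost b ->
  Wval (size b) < dist b.
Proof.
move=> b1 cb; rewrite dist_rec; last by case: b b1 {cb}.
by have := Wval2 b1; have := dist_ge0 (map (@pull R) b); lra.
Qed.

Lemma cost_ge0 b : 0 <= cost b.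
Proof.
by rewrite mulr_ge0 ?divr_ge0// intab_ge0// => x _; exact: sqd_ge0.
Qed.

(** The threshold is the distortion of a single point at 0 or at 1. *)
Lemma dist_gt_right b : (1 < size b)%N -> 25 / 204 + 1 / 4 <= dist (map (@pull R) b) ->
  Wval (size b) < dist b.
Proof.
move=> b1 db; rewrite dist_rec; last by case: b b1 {db}.
by have := Wval2 b1; have := cost_ge0 b; lra.
Qed.

Lemma le_sqr_norm (y z : R) : - z <= y -> y <= z -> y ^+ 2 <= z ^+ 2.
Proof. by move=> h1 h2; nra. Qed.

Lemma bounded_below1 c : bounded_below [:: c].
Proof.
have W1 : Wval 1 = 25 / 204.
  apply/eqP; rewrite eq_le Wval1//=; apply: Wval_ge => // -[//|n ns] /=.
  by rewrite /posseq /= => /andP[? _]; lia.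
rewrite /bounded_below /= W1 dist1; split; first by have := sqr_ge0 (c - 1 / 2); lra.
move=> h; have c2 : c = 1 / 2.
  apply/eqP; rewrite -subr_eq0 -sqrf_eq0; apply/eqP.
  by have := sqr_ge0 (c - 1 / 2); lra.
rewrite c2; split=> [d|]; first by rewrite inE => /eqP ->; lra.
case=> [_|n ns [/(_ 0%N isT)[/= -> + _]]].
  by rewrite /=; have := sqr_ge0 (1 / 2 - 1 / 2 : R); lra.
rewrite addn0 /inJ expr0 expr1 invr1.
by case: andP => // -[h1 h2]; exfalso; lra.
Qed.

End LowerBound.

(** * Lower bound on the distortion *)

Section Induction.
Variable R : realType.
Implicit Types (x c p v : R) (b s : seq R) (i l n N : nat) (ns : seq nat).

Lemma rescaled_uniq b : uniq b -> uniq (rescaled b).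
Proof. by move=> ub; rewrite map_inj_uniq ?filter_uniq//; exact: pull_inj. Qed.

Lemma size_rescaled b : size (rescaled b) = size (rpart b).
Proof. by rewrite size_map. Qed.

Lemma size_gt0_neq (s : seq R) : (0 < size s)%N -> s != [::].
Proof. by case: s. Qed.

Lemma ex_mem b (P : pred R) :
  (exists2 c, c \in b & P c) \/ {in b, forall c, ~~ P c}.
Proof.
have [/hasP|/hasPn] := boolP (has P b); first by left.
by right.
Qed.

(** With an empty gap the two sides decouple: left points serve $J_1$, right points serve the rest,
    and the bounds for the two sides add up. *)
Lemma bounded_below_split b : uniq b -> gpart b = [::] ->
  (exists2 c, c \in b & 0 <= c <= 1 / 3) ->
  (exists2 c, c \in b & 2 / 3 <= c <= 1) ->
  bounded_below (rescaled b) -> bounded_below b.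
Proof.
move=> ub g0 [cl clb /andP[cl0 cl3]] [cr crb /andP[cr2 cr1]] [IH1 IH2].
have gap c : c \in b -> c <= 1 / 3 \/ 2 / 3 <= c.
  move=> cb; have [?|h1] := leP c (1 / 3); first by left.
  have [?|h2] := leP (2 / 3) c; first by right.
  have : c \in gpart b by rewrite mem_filter h1 h2 cb.
  by rewrite g0.
have b0 : b != [::] by apply: contraTneq clb => ->.
have lcl : cl \in lpart b by rewrite mem_filter cl3.
have rcr : pull cr \in rescaled b by apply: map_f; rewrite mem_filter cr2.
have l0 : (0 < size (lpart b))%N by rewrite lt0n size_eq0; apply: contraTneq lcl => ->.
have r0 : (0 < size (rescaled b))%N by rewrite lt0n size_eq0; apply: contraTneq rcr => ->.
have sz : (size (lpart b) + size (rescaled b) = size b)%N.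
  by rewrite -(size_parts b) g0 size_rescaled addn0.
have b1 : size b <> 1%N by move: sz l0 r0; clear; lia.
(* Points from 2/3 on are at least 1/3 away from $J_1$, hence no nearer than [cl]. *)
have cL : cost (lpart b) <= cost b.
  apply: le_cost => x /andP[x0 x3]; apply: sqd_dom => // c cb.
  have [c3|c2] := gap c cb; first by exists c; rewrite ?mem_filter ?c3.
  by exists cl => //; rewrite -[leRHS]sqrrN; apply: le_sqr_norm; lra.
(* Left points are pulled to at most -1, hence are no nearer to [[0, 1]] than [pull cr]. *)
have dR : dist (rescaled b) <= dist (map (@pull R) b).
  apply: le_dist => x /andP[x0 x1]; apply: sqd_dom; first by case: (b) b0.
  move=> _ /mapP[c cb ->]; have [c3|c2] := gap c cb; last first.
    by exists (pull c); rewrite // map_f// mem_filter c2.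
  by exists (pull cr) => //; apply: le_sqr_norm; rewrite /pull; lra.
have W := Wval_step R l0 r0 (eq_leq sz).
have cg := cost_ge (size_gt0_neq l0).
rewrite /bounded_below dist_rec//; split; first by lra.
move=> h; have eqd : dist (rescaled b) <= Wval R (size (rescaled b)) by lra.
have [in01 hns] := IH2 eqd.
have Lin c : c \in lpart b -> 0 <= c <= 1 / 3.
  move=> cl'; have [c0|c0] := leP c 0.
    by have := cost_gt_out cl' (or_introl c0); lra.
  by move: cl'; rewrite mem_filter => /andP[-> _]; rewrite ltW.
have b01 c : c \in b -> 0 <= c <= 1.
  move=> cb; have [c3|c2] := gap c cb.
    have /Lin : c \in lpart b by rewrite mem_filter c3.
    by lra.
  have : pull c \in rescaled b by rewrite map_f// mem_filter c2.
  by move/in01; rewrite /pull; lra.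
split=> // -[|n ns] cn.
  (* The empty sequence would require exactly one point in [[0, 1]], which contains all of [b]. *)
  have [_] := cn; rewrite (_ : count _ b = size b); first by move/b1.
  apply/eqP; rewrite -all_count; apply/allP => c /b01 /=.
  by rewrite expr0 invr1 subrr.
have [-> cn'] := canon_rescaled cn.
have -> : count (inJ 1) b = size (lpart b).
  rewrite /lpart size_filter; apply: eq_in_count => c cb.
  rewrite inJ_bounds expr0 expr1 invr1 subrr.
  have -> : 1 - 2 / 3 = 1 / 3 :> R by field.
  by have [c3|c2] := leP c (1 / 3); rewrite ?andbF// andbT; have /andP[] := b01 c cb.
by have /= := hns _ cn'; lra.
Qed.

Lemma pull_gap_lt0 p : p < 2 / 3 -> pull p < 0 :> R.
Proof. by rewrite /pull; lra. Qed.

Lemma lt_step (w k w' c c' d d' : R) : w <= k + w' / 18 -> k < c' -> c' <= c ->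
  w' <= d' -> d' <= d -> w < c + d / 18.
Proof. by lra. Qed.

Lemma lt_step' (w k w' c c' d d' : R) : w <= k + w' / 18 -> k <= c' -> c' <= c ->
  w' < d' -> d' <= d -> w < c + d / 18.
Proof. by lra. Qed.

(** Since z + 1/2 is at most 3z/2, the second term is at least 4/9 of the first, and the first is at
    most 1/216. *)
Lemma half_point_gain (z : R) : 1 <= z ->
  (216 * z ^+ 2)^-1 - (216 * (z + 1 - 1 / 2) ^+ 2)^-1 <= 5 / 9 / 216.
Proof.
move=> z1; have -> : z + 1 - 1 / 2 = z + 1 / 2 by field.
have e (y : R) : (216 * y)^-1 = 216^-1 * y^-1 by exact: invfM.
rewrite !e -mulrBr mulrC ler_wpM2r ?invr_ge0//.
have z2 : 0 < z ^+ 2 by rewrite exprn_gt0//; lra.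
have z3 : 0 < (z + 1 / 2) ^+ 2 by rewrite exprn_gt0//; lra.
have h : (9 / 4 * z ^+ 2)^-1 <= ((z + 1 / 2) ^+ 2)^-1.
  by rewrite lef_pV2 ?posrE; [nra|lra|lra].
have h' : (z ^+ 2)^-1 <= 1 by rewrite invf_le1// exprn_ege1.
move: h; rewrite invfM (_ : (9 / 4 : R)^-1 = 4 / 9); last by field.
by move: ((z ^+ 2)^-1) h' (((z + 1 / 2) ^+ 2)^-1) => y h' y'; lra.
Qed.

(** Among the gap points only the leftmost [p] can serve $J_1$ and only the rightmost [q] can serve
    [[2/3, 1]]; each case trades them for better placed points. *)
Lemma dist_gt_gap b : uniq b -> gpart b != [::] ->
  (0 < size (lpart b))%N -> (0 < size (rpart b))%N ->
  (forall s, uniq s -> (0 < size s < size b)%N -> bounded_below s) ->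
  Wval R (size b) < dist b.
Proof.
move=> ub g0 l0 r0 IH.
have [p pg pmin] := seq_min g0; have [q qg qmax] := seq_max g0.
have sz := size_parts b.
have b0 : b != [::] by case: (b) g0.
have [pb p1 p2] : [/\ p \in b, 1 / 3 < p & p < 2 / 3].
  by move: pg; rewrite mem_filter => /andP[/andP[? ?] ?].
have [qb q1 q2] : [/\ q \in b, 1 / 3 < q & q < 2 / 3].
  by move: qg; rewrite mem_filter => /andP[/andP[? ?] ?].
have cL : cost (p :: lpart b) <= cost b.
  apply: le_cost => x /andP[x0 x3]; apply: sqd_dom => // c cb.
  have [c3|c3] := leP c (1 / 3).
    by exists c; rewrite // inE mem_filter c3 cb orbT.
  exists p; rewrite ?mem_head// -[leRHS]sqrrN.
  have pc : p <= c.
    have [c2|c2] := leP (2 / 3) c; first by lra.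
    by apply: pmin; rewrite mem_filter c3 c2.
  by apply: le_sqr_norm; lra.
have dR : dist (pull q :: rescaled b) <= dist (map (@pull R) b).
  apply: le_dist => x /andP[x0 x1]; apply: sqd_dom; first by case: (b) b0.
  move=> _ /mapP[c cb ->]; have [c2|c2] := leP (2 / 3) c.
    by exists (pull c); rewrite // inE map_f ?orbT// mem_filter c2.
  exists (pull q); rewrite ?mem_head//.
  have cq : c <= q.
    have [c3|c3] := leP c (1 / 3); first by lra.
    by apply: qmax; rewrite mem_filter c3 c2.
  by apply: le_sqr_norm; rewrite /pull; lra.
have g1 : (0 < size (gpart b))%N by rewrite lt0n size_eq0.
have uq : uniq (pull q :: rescaled b).
  rewrite /= rescaled_uniq// andbT; apply/mapP => -[c].
  by rewrite mem_filter => /andP[c2 _] /pull_inj e; move: q2; rewrite e; lra.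
have IHq : bounded_below (pull q :: rescaled b).
  by apply: IH => //=; rewrite size_rescaled; move: sz g1 l0; clear; lia.
have [Wq Wq'] := IHq; rewrite /= size_rescaled in Wq Wq'.
set i := size (lpart b) in l0 sz *; set l := size (rpart b) in r0 sz Wq Wq' *.
set g := size (gpart b) in g1 sz *.
have cost_gt : (216 * i.+1%:R ^+ 2)^-1 < cost (p :: lpart b).
  by apply: (@cost_gt_out _ (p :: lpart b) p); rewrite ?mem_head//; right; lra.
rewrite dist_rec//.
(* With two gap points or more, each side can be given one of them; the one for $J_1$ was strictly
   misplaced. *)
have [gg|gg] := ltnP 1 g.
  have := @Wval_step R (size b) i.+1 l.+1 isT isT.
  have -> : (i.+1 + l.+1 <= size b)%N by move: sz gg; clear; lia.
  by move=> /(_ isT) W; exact: (lt_step W cost_gt cL Wq dR).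
have gE : g = 1%N by move: gg g1; clear; lia.
have qp : q = p.
  move: pg qg; rewrite -/(gpart b); move: gE; rewrite /g.
  by case: (gpart b) => [|z [|]]//= _; rewrite !inE => /eqP -> /eqP ->.
subst q.
(* A single gap point from 1/2 on is too far to help $J_1$, and it is pulled below 0, so the right
   side is not optimal. *)
have [ph|ph] := leP (1 / 2) p.
  have cf := @cost_ge_far _ (lpart b) p (size_gt0_neq l0) ph.
  have := @Wval_step R (size b) i l.+1 l0 isT.
  have -> : (i + l.+1 <= size b)%N by move: sz gE; clear; lia.
  move=> /(_ isT) W.
  have : Wval R l.+1 < dist (pull p :: rescaled b).
    rewrite ltNge; apply/negP => /Wq'[+ _] => /(_ (pull p)).
    by rewrite mem_head => /(_ isT); have := pull_gap_lt0 p2; lra.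
  by move=> Wp; exact: (lt_step' W cf cL Wp dR).
have pp : pull p <= - (1 / 2) by rewrite /pull; lra.
have rge0 c : c \in rescaled b -> 0 <= c.
  by move=> /mapP[d]; rewrite mem_filter => /andP[? _] ->; rewrite /pull; lra.
(* A rescaled point in [[0, 1/2]] is nearer to all of [[0, 1]] than [pull p]; then [p] is useless on
   the right and is moved into $J_1$. *)
have [[c cr ch]|far] := ex_mem (rescaled b) (fun c => c <= 1 / 2).
  have dRR : dist (rescaled b) <= dist (pull p :: rescaled b).
    apply: le_dist => x /andP[x0 x1]; apply: sqd_dom => // d.
    rewrite inE => /predU1P[->|dr]; last by exists d.
    by exists c => //; apply: le_sqr_norm; have := rge0 c cr; lra.
  have [Wr _] : bounded_below (rescaled b).
    by apply: IH; [exact: rescaled_uniq|rewrite size_rescaled -/l; move: sz l0 r0; clear; lia].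
  rewrite size_rescaled -/l in Wr.
  have := @Wval_step R (size b) i.+1 l isT r0.
  have -> : (i.+1 + l <= size b)%N by move: sz gE; clear; lia.
  by move=> /(_ isT) W; exact: (lt_step W cost_gt cL (le_trans Wr dRR) dR).
(* Otherwise the right side has no point strictly between -1/2 and 1/2, so its first segment costs
   at least as much as with the single point 1/2. *)
have d13 : 13 / 216 <= dist (pull p :: rescaled b).
  rewrite dist_rec//.
  have : cost [:: 1 / 2] <= cost (pull p :: rescaled b).
    apply: le_cost => x /andP[x0 x3]; apply: sqd_dom => // d dr.
    exists (1 / 2); first exact: mem_head.
    move: dr; rewrite inE => /predU1P[->|dr].
      by apply: le_sqr_norm; lra.
    rewrite -[leRHS]sqrrN; have := far d dr; rewrite -ltNge => ?.
    by apply: le_sqr_norm; lra.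
  rewrite cost1; have := dist_ge0 (map (@pull R) (pull p :: rescaled b)); lra.
have co : (216 * (i.+1%:R - 1 / 2) ^+ 2)^-1 <= cost (p :: lpart b).
  by apply: (@cost_ge_out _ (p :: lpart b) p); rewrite ?mem_head//; right; lra.
have := @Wval_step R (size b) i l.+1 l0 isT.
have -> : (i + l.+1 <= size b)%N by move: sz gE; clear; lia.
(* On $J_1$ the point [p] gains at most half a point, 5/9/216; this is less than the loss
   [(13 / 216 - Wval R l.+1) / 18] on the right. *)
move=> /(_ isT) W; have W2 := @Wval2 R l.+1 r0.
have i1 : 1 <= i%:R :> R by rewrite ler1n.
have hg := half_point_gain i1; rewrite natr1 in hg.
move: W W2 co cL d13 dR hg; clear.
move: (Wval R (size b)) (Wval R l.+1) (dist _) (dist _) (cost _) (cost _).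
move: ((216 * i%:R ^+ 2)^-1) ((216 * (i.+1%:R - 1 / 2) ^+ 2)^-1).
by move=> *; lra.
Qed.

Theorem dist_bounded_below b : uniq b -> b != [::] -> bounded_below b.
Proof.
have [n] := ubnP (size b); elim: n b => // n IHn b; rewrite ltnS => bn ub b0.
have IH s : uniq s -> (0 < size s < size b)%N -> bounded_below s.
  move=> us /andP[s0 sb]; apply: IHn => //; first exact: leq_trans sb bn.
  by case: (s) s0.
have [b1|b1] := leqP (size b) 1.
  by case: b b0 b1 {bn ub IH} => [//|c [|//]] _ _; exact: bounded_below1.
have [g0|g0] := eqVneq (gpart b) [::].
  have gap c : c \in b -> c <= 1 / 3 \/ 2 / 3 <= c.
    move=> cb; have [?|h1] := leP c (1 / 3); first by left.
    have [?|h2] := leP (2 / 3) c; first by right.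
    have : c \in gpart b by rewrite mem_filter h1 h2 cb.
    by rewrite g0.
  have [exl|nol] := ex_mem b (fun c => 0 <= c <= 1 / 3); last first.
    apply/bounded_below_gt/dist_gt_left => //.
    (* All points are below 0 or from 2/3 on, hence no nearer to $J_1$ than 0 is. *)
    have : cost [:: 0] <= cost b.
      apply: le_cost => x /andP[x0 x3]; apply: sqd_dom => // c cb.
      exists 0; rewrite ?mem_head// subr0; have := nol c cb.
      have [c3|c2 _] := gap c cb.
        by rewrite c3 andbT -ltNge => c0; apply: le_sqr_norm; lra.
      by rewrite -[leRHS]sqrrN; apply: le_sqr_norm; lra.
    by rewrite cost1; lra.
  have [exr|nor] := ex_mem b (fun c => 2 / 3 <= c <= 1); last first.
    apply/bounded_below_gt/dist_gt_right => //.
    (* Pulled points are at most -1 or exceed 1, hence no nearer to [[0, 1]] than 1 is. *)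
    have : dist [:: 1] <= dist (map (@pull R) b).
      apply: le_dist => x /andP[x0 x1]; apply: sqd_dom; first by case: (b) b0.
      move=> _ /mapP[c cb ->].
      exists 1; rewrite ?mem_head// -sqrrN; have := nor c cb.
      have [c3 _|c2] := gap c cb.
        by apply: le_sqr_norm; rewrite /pull; lra.
      rewrite c2 /= -ltNge => c1; rewrite -[leRHS]sqrrN.
      by apply: le_sqr_norm; rewrite /pull; lra.
    by rewrite dist1; lra.
  apply: bounded_below_split => //; apply: IH; first exact: rescaled_uniq.
  have [cl clb /andP[_ cl3]] := exl; have [cr crb /andP[cr2 _]] := exr.
  have := size_parts b; rewrite size_rescaled g0 /=.
  have : (0 < size (lpart b))%N.
    by rewrite size_filter -has_count; apply/hasP; exists cl.
  have : (0 < size (rpart b))%N.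
    by rewrite size_filter -has_count; apply/hasP; exists cr.
  by move=> r1 l1 <-; rewrite r1 addn0 -[ltnLHS]add0n ltn_add2r l1.
apply: bounded_below_gt.
have [l0|l0] := posnP (size (lpart b)).
  apply: dist_gt_left => //.
  have : cost [:: 1 / 3] <= cost b.
    apply: le_cost => x /andP[x0 x3]; apply: sqd_dom => // c cb.
    exists (1 / 3); first exact: mem_head.
    have c3 : 1 / 3 < c.
      rewrite ltNge; apply/negP => c3; move/size0nil: l0.
      have : c \in lpart b by rewrite mem_filter c3.
      by move=> + e; rewrite e.
    by rewrite -[leRHS]sqrrN; apply: le_sqr_norm; lra.
  by rewrite cost1; lra.
have [r0|r0] := posnP (size (rpart b)).
  apply: dist_gt_right => //.
  have : dist [:: 0] <= dist (map (@pull R) b).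
    apply: le_dist => x /andP[x0 x1]; apply: sqd_dom; first by case: (b) b0.
    move=> _ /mapP[c cb ->]; exists 0; rewrite ?mem_head//.
    have c3 : c < 2 / 3.
      rewrite ltNge; apply/negP => c3; move/size0nil: r0.
      have : c \in rpart b by rewrite mem_filter c3.
      by move=> + e; rewrite e.
    by apply: le_sqr_norm; rewrite /pull; lra.
  by rewrite dist1; lra.
exact: dist_gt_gap.
Qed.

End Induction.

(** * The point set of a canonical sequence *)

Section UpperBound.
Variable R : realType.
Implicit Types (x c p v : R) (b s : seq R) (i l n N : nat) (ns : seq nat).

Definition push c : R := 3^-1 * c + 2 / 3.

Lemma pushK : cancel push (@pull R).
Proof. by move=> c; rewrite /push /pull; field. Qed.

Fixpoint pts ns : seq R :=
  if ns is n :: ns' then midpoints R n ++ map push (pts ns') else [:: 1 / 2].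

Lemma midpoints_bounds n c : c \in midpoints R n -> 0 < c < 1 / 3.
Proof.
move=> /mapP[i]; rewrite mem_iota /= add0n => lt_in ->.
have n0 : 0 < n%:R :> R by rewrite ltr0n; apply: leq_ltn_trans lt_in.
have i0 : 0 <= i%:R :> R by [].
have lt : i%:R + 1 <= n%:R :> R by rewrite natr1 ler_nat.
apply/andP; split; first by rewrite divr_gt0//; lra.
by rewrite ltr_pdivrMr; lra.
Qed.

Lemma size_midpoints n : size (midpoints R n) = n.
Proof. by rewrite size_map size_iota. Qed.

Lemma midpoints_uniq n : uniq (midpoints R n).
Proof.
rewrite map_inj_in_uniq ?iota_uniq// => i j; rewrite mem_iota /= add0n => lt_in _.
have n0 : n%:R != 0 :> R by rewrite pnatr_eq0 -lt0n; apply: leq_ltn_trans lt_in.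
move/(congr1 (fun y => y * (6 * n%:R))); rewrite !divfK ?mulf_neq0// => e.
by apply/eqP; rewrite -(eqr_nat R); apply/eqP; lra.
Qed.

Lemma pts01 ns c : c \in pts ns -> 0 <= c <= 1.
Proof.
elim: ns c => [|n ns IH] c; first by rewrite inE => /eqP ->; lra.
rewrite mem_cat => /orP[/midpoints_bounds|/mapP[d /IH + ->]]; rewrite /push; lra.
Qed.

Lemma pts_uniq ns : uniq (pts ns).
Proof.
elim: ns => //= n ns IH; rewrite cat_uniq midpoints_uniq/= map_inj_uniq ?IH ?andbT.
  apply/hasPn => _ /mapP[d /pts01 d01 ->]; apply/negP => /midpoints_bounds.
  by rewrite /push; lra.
exact: can_inj pushK.
Qed.

Lemma size_pts ns : size (pts ns) = (sumn ns).+1.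
Proof.
by elim: ns => //= n ns IH; rewrite size_cat size_midpoints size_map IH addnS.
Qed.

Lemma pts_neq0 ns : pts ns != [::].
Proof. by rewrite -size_eq0 size_pts. Qed.

(** Serving each column by its own points and the tail by the last point can only overestimate the
    distance to the nearest point. *)
Lemma dist_pts ns : posseq ns -> dist (pts ns) <= Fval R ns.
Proof.
elim: ns => [_|n ns IH /andP[n0 pns]] /=.
  rewrite dist1; have -> : (1 / 2 - 1 / 2 : R) = 0 by rewrite subrr.
  by rewrite expr0n addr0.
rewrite dist_rec; last exact: (pts_neq0 (n :: ns)).
apply: lerD.
  apply: le_trans (cost_midpoints R n0); apply: le_cost => x _.
  apply: sqd_dom; first by rewrite -size_eq0 size_midpoints -lt0n.
  by move=> c cm; exists c; rewrite // mem_cat cm.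
rewrite ler_wpM2r ?invr_ge0//; apply: le_trans (IH pns).
apply: le_dist => x _; apply: sqd_dom; first exact: pts_neq0.
move=> c cp; exists c => //; apply/mapP; exists (push c); last by rewrite pushK.
by rewrite mem_cat map_f ?orbT.
Qed.

Lemma canon_pts ns : posseq ns -> canon_counts (pts ns) ns.
Proof.
elim: ns => [_|n ns IH /andP[n0 pns]].
  split=> //=; rewrite expr0 invr1 subrr.
  by have -> : (0 <= 1 / 2 :> R) && (1 / 2 <= 1 :> R) by lra.
have [h t] := IH pns; split => [[_|j js]|] /=.
- split=> //; rewrite count_cat.
  have /eqP -> : count (inJ 1) (midpoints R n) == n.
    rewrite -{2}(size_midpoints n) -all_count; apply/allP => c /midpoints_bounds.
    rewrite inJ_bounds expr0 expr1 invr1 subrr; lra.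
  rewrite (_ : count _ (map _ _) = 0%N) ?addn0//.
  apply/eqP; rewrite -leqn0 leqNgt -has_count; apply/hasPn => _ /mapP[d /pts01 d01 ->].
  rewrite inJ_bounds expr0 expr1 invr1 subrr; apply/negP; rewrite /push; lra.
- have [h1 h2] := h j js; split=> //; rewrite h1 count_cat count_map.
  rewrite (_ : count _ (midpoints R n) = 0%N) ?add0n.
    by apply: eq_count => c /=; rewrite -inJ_pull pushK.
  apply/eqP; rewrite -leqn0 leqNgt -has_count; apply/hasPn => c /midpoints_bounds c3.
  by apply/negP => /inJS_ge; lra.
have k0 : 0 < (3 ^+ size ns : R)^-1 by rewrite invr_gt0 exprn_gt0.
have k1 : (3 ^+ size ns : R)^-1 <= 1.
  by rewrite invf_le1 ?exprn_gt0// exprn_ege1// ler1n.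
rewrite count_cat count_map exprS invfM.
rewrite (_ : count _ (midpoints R n) = 0%N) ?add0n.
  apply: etrans t; apply: eq_count => c /=; rewrite /push.
  by apply/idP/idP => /andP[h1 h2]; apply/andP; split; lra.
apply/eqP; rewrite -leqn0 leqNgt -has_count; apply/hasPn => c /midpoints_bounds c3.
by apply/negP; lra.
Qed.

Lemma canon_sum b ns : canon_counts b ns -> (sumn ns < size b)%N.
Proof.
elim: ns b => [|n ns IH] b cn.
  by have [_ <-] := cn; exact: count_size.
have [-> /IH] := canon_rescaled cn; rewrite size_rescaled => h /=.
have : (count (inJ 1) b <= size (lpart b))%N.
  rewrite size_filter; apply: sub_count => c /=.
  by rewrite inJ_bounds expr0 expr1 invr1 subrr; lra.
move: (size_parts b) h; move: (count _ _) (sumn _) => u v.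
move: (size (lpart b)) (size (gpart b)) (size (rpart b)) (size b) => *; lia.
Qed.

Lemma canon_pos b ns : canon_counts b ns -> posseq ns.
Proof. by move=> [h _]; apply/(all_nthP 0%N) => j /h[]. Qed.

Lemma canonical_seq_ofP b ns : canonical_seq_of b (rcons ns 1%N) <->
  (0 < size ns)%N /\ canon_counts (undup b) ns.
Proof.
split=> [[ms [/rcons_inj[<-] [k0 [h1 [h2 h3]]]]]|[k0 [h1 h2]]].
  split=> //; split=> // j js; have j1 : (1 <= j.+1 <= size ns)%N by [].
  by rewrite (h3 j.+1 j1); split=> //; exact: h1.
exists ns; split=> //; split=> //; split.
  by case=> [//|j] js; rewrite /nJ; have [<-] := h1 j js.
by split=> // -[//|j] /= js; have [] := h1 j js.
Qed.

Lemma dist_undup b : dist (undup b) = dist b.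
Proof.
have [->//|b0] := eqVneq b [::].
have u0 : undup b != [::] by apply: contra_neq b0 => /undup_nil.
by apply/eqP; rewrite eq_le; apply/andP; split; apply: le_dist => x _;
  apply: sqd_dom => // c; rewrite ?mem_undup => cb; exists c; rewrite ?mem_undup.
Qed.

(** The empty minimum is infinite and $J_1$ has positive measure. This discards the empty
    competitor, for which [dist] is meaningless. *)
Lemma distortion_nil : distortion ([::] : seq R) = +oo%E.
Proof.
rewrite /distortion.
pose J := \bigcup_m [set x : R | inJ m.+1 x].
have mJ m : measurable [set x : R | inJ m.+1 x].
  by rewrite inJ_itv; exact: measurable_itv.
transitivity (\int[lebesgue_measure]_(x in J) (+oo : \bar R))%E.
  rewrite [RHS]integral_mkcond; apply: eq_integral => x _; rewrite big_nil patchE.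
  case: ifPn => [|/negP xJ].
    by rewrite inE => -[m _ /dens_inJ ->]; rewrite gt0_muley.
  rewrite dens_notinJ ?mul0e// => -[m mx]; apply: xJ; rewrite inE.
  by exists m.
have mbJ : measurable J by apply: bigcup_measurable.
rewrite integral_cst//.
rewrite gt0_mulye//.
have : (lebesgue_measure [set x : R | inJ 1 x] <= lebesgue_measure J)%E.
  apply: le_measure; [rewrite inE; exact: mJ|rewrite inE; exact: mbJ|].
  by move=> x Jx; exists 0%N.
rewrite inJ_itv lebesgue_measure_itv /= expr0 expr1 invr1 subrr.
rewrite lte_fin (_ : 0 < 1 - 2 / 3 :> R); last by lra.
by apply: lt_le_trans; rewrite lte_fin; lra.
Qed.

End UpperBound.

(** * The greedy step *)

Section Greedy.
Variable R : realType.
Implicit Types (i j k n t : nat) (ns ms : seq nat).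

(** The drop in error when a column passes from [n] to [n.+1] points, up to the factor $18^{-j}$ of
    column $j$. *)
Definition gain n : R := ((n%:R ^+ 2)^-1 - (n.+1%:R ^+ 2)^-1) / 12.

Lemma gain1 : gain 1 = 1 / 16.
Proof. by rewrite /gain; field. Qed.

Lemma gain_ge0 n : (0 < n)%N -> 0 <= gain n.
Proof.
move=> n0; rewrite /gain divr_ge0// subr_ge0 lef_pV2 ?posrE ?exprn_gt0 ?ltr0n//.
by rewrite ler_pXn2r ?nnegrE// ler_nat.
Qed.

Lemma gain_decr m n : (0 < m)%N -> (m <= n)%N -> gain n <= gain m.
Proof.
move=> m0; elim: n => [|n IH]; first by case: m m0.
rewrite leq_eqVlt => /predU1P[->//|mn]; apply: le_trans (IH mn).
rewrite /gain ler_wpM2r ?invr_ge0// -[n.+2%:R]natr1 -[n.+1%:R]natr1.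
have : 1 <= n%:R :> R by rewrite ler1n; exact: leq_trans m0 mn.
move: (n%:R : R) => y y1; rewrite -subr_ge0.
have -> : (y ^+ 2)^-1 - ((y + 1) ^+ 2)^-1 - (((y + 1) ^+ 2)^-1 - ((y + 1 + 1) ^+ 2)^-1)
   = (6 * (y + 1) ^+ 2 - 2) / (y ^+ 2 * (y + 1) ^+ 2 * (y + 1 + 1) ^+ 2).
  by field; lra.
apply: divr_ge0; first by nra.
by apply: mulr_ge0; [apply: mulr_ge0|]; exact: sqr_ge0.
Qed.

Definition incr ns i := set_nth 0%N ns i (nth 0%N ns i).+1.

Lemma sumn_incr ns i : (i < size ns)%N -> sumn (incr ns i) = (sumn ns).+1.
Proof.
elim: ns i => // n ns IH [_|i lis] //=.
by have := IH i lis; rewrite /incr => ->; rewrite addnS.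
Qed.

Lemma size_incr ns i : (i < size ns)%N -> size (incr ns i) = size ns.
Proof. by move=> lis; rewrite size_set_nth; apply/maxn_idPr. Qed.

Lemma posseq_incr ns i : (i < size ns)%N -> posseq ns -> posseq (incr ns i).
Proof.
move=> lis /(all_nthP 0%N) pns; apply/(all_nthP 0%N) => j; rewrite size_incr// => js.
by rewrite nth_set_nth /=; case: eqP => // _; exact: pns.
Qed.

Lemma Fval_incr ns i : (i < size ns)%N -> posseq ns ->
  Fval R (incr ns i) = Fval R ns - gain (nth 0%N ns i) / 18 ^+ i.+1.
Proof.
elim: ns i => // n ns IH [_|i lis] /andP[n0 pns] /=.
  have n0' : n%:R != 0 :> R by rewrite pnatr_eq0 -lt0n.
  have n1' : n.+1%:R != 0 :> R by rewrite pnatr_eq0.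
  rewrite /gain expr1; move: (n%:R : R) (n.+1%:R : R) n0' n1' => y z y0 z0.
  by field; rewrite y0 z0.
rewrite -/(incr ns i) IH// [18 ^+ i.+2]exprS.
have e0 : 18 ^+ i.+1 != 0 :> R by rewrite expf_neq0.
move: (18 ^+ i.+1 : R) e0 ((216 * _)^-1) (gain _) (Fval _ _) => e e0 *.
by field.
Qed.

(** The constant is 2 = 17 * 25/204 - 1/12: the tail error shrinks by 18 and one new column with a
    single point is paid for. *)
Lemma Fval_rcons1 ns : Fval R (rcons ns 1%N) = Fval R ns - 2 / 18 ^+ (size ns).+1.
Proof.
elim: ns => [|n ns IH] /=; first by rewrite expr1n; field.
rewrite IH [18 ^+ (size ns).+2]exprS.
have e0 : 18 ^+ (size ns).+1 != 0 :> R by rewrite expf_neq0.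
move: (18 ^+ (size ns).+1 : R) e0 ((216 * _)^-1) (Fval _ _) => e e0 *.
by field.
Qed.

Lemma Fval_sum ns : Fval R ns =
  \sum_(j < size ns) term R ns j.+1 + 25 / 204 * (18 ^+ size ns)^-1.
Proof.
elim: ns => [|n ns IH] /=; first by rewrite big_ord0 expr0 invr1 mulr1 add0r.
rewrite big_ord_recl {}IH [_ / 18]mulrDl -[RHS]addrA.
have -> : term R (n :: ns) (ord0 : 'I_(size ns).+1).+1 = (216 * n%:R ^+ 2)^-1.
  rewrite /term /= expr1 [RHS]invfM.
  by move: ((n%:R ^+ 2)^-1 : R) => y; field.
have e0 k : 18 ^+ k != 0 :> R by rewrite expf_neq0.
congr (_ + (_ + _)); last by rewrite [18 ^+ (size ns).+1]exprS; field.
rewrite big_distrl /=; apply: eq_bigr => j _; rewrite /term /= [18 ^+ (bump _ _).+1]exprS.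
by move: ((_ ^+ 2)^-1) => y; field.
Qed.

(** With [Vinf_rcons], this turns the candidates compared in the theorem into values of sequences;
    [VA] counts columns from 1, [incr] from 0. *)
Lemma VA_incr ns i : (i < size ns)%N -> VA R ns i.+1 = Fval R (incr ns i).
Proof.
move=> lis; rewrite Fval_sum size_incr// /VA /=; congr (_ + _).
rewrite [RHS](bigD1 (Ordinal lis)) //= addrC; congr (_ + _); last first.
  by rewrite /term /incr /= nth_set_nth /= eqxx.
apply: eq_big => [j|j ji]; first by rewrite eqSS.
by rewrite /term /incr /= nth_set_nth /= -[j == i :> nat]eqSS (negPf ji).
Qed.

Lemma Vinf_rcons ns : Vinf R ns = Fval R (rcons ns 1%N).
Proof.
rewrite Fval_rcons1 Fval_sum /Vinf /= -!addrA; congr (_ + _).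
rewrite !exprS; have e0 : 18 ^+ size ns != 0 :> R by rewrite expf_neq0.
by field.
Qed.

Lemma sumn_le_nth ms ns : (forall j, nth 0 ms j <= nth 0 ns j)%N ->
  (sumn ms <= sumn ns)%N.
Proof.
elim: ms ns => // m ms IH [|n ns] h /=.
  have : all (pred1 0%N) (m :: ms).
    by apply/(all_nthP 0%N) => j _; have := h j; rewrite nth_nil leqn0.
  move=> /= /andP[/eqP -> a]; rewrite add0n leqn0; elim: ms a {IH h} => //= u ms IH.
  by move=> /andP[/eqP -> /IH].
by apply: leq_add; [exact: (h 0%N)|apply: IH => j; exact: (h j.+1)].
Qed.

Lemma decr_ex ms j : (1 < nth 0 ms j)%N -> posseq ms ->
  exists ms', [/\ (j < size ms')%N, posseq ms', nth 0%N ms' j = (nth 0%N ms j).-1 &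
    ms = incr ms' j].
Proof.
elim: ms j => [|m ms IH] [|j] //=.
  case: m => [//|m] m1 /andP[_ pms]; exists (m :: ms); split=> //=.
  exact/andP.
move=> m1 /andP[m0 pms]; have [ms' [js pm e1 e2]] := IH j m1 pms.
exists (m :: ms'); split=> //=; first exact/andP.
by rewrite /incr /= -/(incr ms' j) -e2.
Qed.

Lemma gain_shrink (g g' : R) i j : 0 <= g' -> g <= g' -> (i <= j)%N ->
  g / 18 ^+ j <= g' / 18 ^+ i.
Proof.
move=> g0 gg ij.
apply: (@le_trans _ _ (g' / 18 ^+ j)); first by rewrite ler_wpM2r ?invr_ge0 ?exprn_ge0.
rewrite ler_wpM2l// lef_pV2 ?posrE ?exprn_gt0//.
by rewrite ler_weXn2l// ler1n.
Qed.

(* Removing from ms a point that ns does not have costs at least as much as the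
   best addition to ns gains, because the gains decrease along each column and
   the opening gains 2 / 18 ^ j decrease in j. *)
Lemma greedy n ns v : posseq ns -> (sumn ns < n)%N ->
  (forall ms, posseq ms -> (sumn ms < n)%N -> Fval R ns <= Fval R ms) ->
  (forall i, (i < size ns)%N -> v <= Fval R (incr ns i)) ->
  v <= Fval R (rcons ns 1%N) ->
  forall ms, posseq ms -> (sumn ms < n.+1)%N -> v <= Fval R ms.
Proof.
move=> pns sns opt vi vr ms pms; rewrite ltnS leq_eqVlt => /predU1P[sms|sms]; last first.
  apply: le_trans vr _; rewrite Fval_rcons1; have := opt ms pms sms.
  have : 0 <= 2 / 18 ^+ (size ns).+1 :> R by rewrite divr_ge0// exprn_ge0.
  lra.
(* The total of [ms] is now [n], larger than that of [ns]; sequences of different lengths are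
   compared by padding with 0. *)
have [j lj] : exists j, (nth 0 ns j < nth 0 ms j)%N.
  apply/not_existsP => h; move: sns; rewrite -sms ltnNge => /negP; apply.
  by apply: sumn_le_nth => j; rewrite leqNgt; apply/negP/h.
(* In an existing column, the last point of [ms] gains no more than the next point of [ns] would. *)
have [js|js] := ltnP j (size ns).
  have n0 : (0 < nth 0 ns j)%N by exact: (all_nthP 0%N pns).
  have m1 : (1 < nth 0 ms j)%N by exact: leq_ltn_trans lj.
  have [ms' [js' pms' e1 e2]] := decr_ex m1 pms.
  have := vi j js; rewrite Fval_incr// e2 Fval_incr// e1.
  have sms' : (sumn ms' < n)%N by rewrite -sms e2 sumn_incr.
  have := opt _ pms' sms'.
  have : gain (nth 0%N ms j).-1 / 18 ^+ j.+1 <= gain (nth 0%N ns j) / 18 ^+ j.+1.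
    apply: gain_shrink => //; first exact: gain_ge0.
    by apply: gain_decr => //; rewrite -ltnS prednK//; exact: ltnW.
  lra.
have jm : (j < size ms)%N.
  by rewrite ltnNge; apply/negP => h; rewrite (nth_default _ h) in lj.
have km : (size ns < size ms)%N by exact: leq_ltn_trans jm.
move: vr; rewrite Fval_rcons1.
case/lastP: ms pms sms {lj jm} km => // ms t; rewrite /posseq all_rcons size_rcons sumn_rcons.
move=> /andP[t0 pms] sms km.
(* Here [ms] is longer than [ns], and a point is removed from its last column: the whole column if
   it holds a single point, otherwise one point, whose gain is at most 1/16 and so below the opening
   constant 2. *)
case: t t0 sms => [//|[|t]] _ sms.
  rewrite Fval_rcons1; have := opt ms pms.
  have -> : (sumn ms < n)%N by rewrite -sms addn1.
  have := @gain_shrink 2 2 (size ns).+1 (size ms).+1 (ler0n _ 2) (lexx _) km.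
  by move=> h /(_ isT); lra.
have pm : posseq (rcons ms t.+2) by rewrite /posseq all_rcons.
have nt : nth 0%N (rcons ms t.+2) (size ms) = t.+2 by rewrite nth_rcons ltnn eqxx.
have := @decr_ex (rcons ms t.+2) (size ms); rewrite nt => /(_ isT pm).
move=> [ms' [js' pms' e1 e2]]; rewrite e2 Fval_incr// e1 /=.
have sms' : (sumn ms' < n)%N by rewrite -sms -sumn_rcons e2 sumn_incr.
have g2 : gain t.+1 <= 2.
  by apply: le_trans (@gain_decr 1 t.+1 isT isT) _; rewrite gain1; lra.
have := opt _ pms' sms'.
have := @gain_shrink _ _ (size ns).+1 (size ms).+1 (ler0n _ 2) g2 km.
lra.
Qed.

End Greedy.

(** * Optimal sets and minimal sequences *)

Section Main.
Variable R : realType.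

Lemma dist_ge_Wval n v (b : seq R) : b != [::] -> (card_pts b <= n)%N ->
  (forall ms, posseq ms -> (sumn ms < n)%N -> v <= Fval R ms) -> v <= dist b.
Proof.
move=> b0 bn h.
have u0 : undup b != [::] by apply: contra_neq b0 => /undup_nil.
have [+ _] := dist_bounded_below (undup_uniq b) u0.
rewrite dist_undup; apply: le_trans; apply: Wval_ge.
  by rewrite lt0n size_eq0.
by move=> ms pms sms; apply: h => //; exact: leq_trans sms bn.
Qed.

(** Comparison with the sets [pts ms] bounds the distortion of [a] by [Wval], so the equality case
    of [bounded_below] applies to it. *)
Lemma optimal_canon_min n (a : seq R) ns : optimal_set n a ->
  canon_counts (undup a) ns ->
  forall ms, posseq ms -> (sumn ms < n)%N -> Fval R ns <= Fval R ms.
Proof.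
move=> [an aopt] cn ms0 pms0 sms0.
have u0 : undup a != [::].
  by rewrite -size_eq0 -lt0n; apply: leq_ltn_trans (canon_sum cn).
have a0 : a != [::] by apply: contraNneq u0 => ->.
have le ms : posseq ms -> (sumn ms < n)%N -> dist (undup a) <= Fval R ms.
  move=> pms sms; rewrite dist_undup; apply: le_trans (dist_pts R pms).
  rewrite -lee_fin -!distortionE ?pts_neq0// aopt; apply: ereal_inf_lbound.
  by exists (pts R ms) => //=; rewrite /card_pts undup_id ?pts_uniq// size_pts.
have [_ h] := dist_bounded_below (undup_uniq a) u0.
apply: le_trans (le _ pms0 sms0).
have [|_ h'] := h; last exact: h'.
apply: Wval_ge; first by rewrite lt0n size_eq0.
by move=> ms pms sms; apply: le => //; exact: leq_trans sms an.
Qed.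

(** The set [pts ns] is the witness: its distortion is at most [Fval R ns], which by minimality
    bounds every competitor from below. *)
Lemma canonical_seq_min n ns : (0 < size ns)%N -> posseq ns -> (sumn ns < n)%N ->
  (forall ms, posseq ms -> (sumn ms < n)%N -> Fval R ns <= Fval R ms) ->
  canonical_seq R n (rcons ns 1%N).
Proof.
move=> k0 pns sns h; exists (pts R ns).
have cp : (card_pts (pts R ns) <= n)%N.
  by rewrite /card_pts undup_id ?pts_uniq// size_pts.
split; last first.
  by apply/canonical_seq_ofP; rewrite undup_id ?pts_uniq//; split=> //; exact: canon_pts.
split=> //; apply/eqP; rewrite eq_le; apply/andP; split; last first.
  by apply: ereal_inf_lbound; exists (pts R ns).
apply: le_ereal_inf_tmp => _ [b /= bn <-].
have [->|b0] := eqVneq b [::]; first by rewrite distortion_nil leey.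
rewrite !distortionE ?pts_neq0// lee_fin; apply: le_trans (dist_pts R pns) _.
exact: dist_ge_Wval bn h.
Qed.

End Main.

Theorem theorem4p14 (R : realType) (n : nat) (ns : seq nat) :
  (2 <= n)%N ->
  canonical_seq R n (rcons ns 1%N) ->
  (forall m : nat, (1 <= m <= size ns)%N ->
     Vmin R ns = VA R ns m ->
     canonical_seq R n.+1
       (rcons (set_nth 0%N ns m.-1 (nth 0%N ns m.-1).+1) 1%N)) /\
  (Vmin R ns = Vinf R ns ->
     canonical_seq R n.+1 (rcons (rcons ns 1%N) 1%N)).
Proof.
move=> _ [a [aopt /canonical_seq_ofP[k0 cn]]].
have pns := canon_pos cn.
have sns : (sumn ns < n)%N by have [an _] := aopt; exact: leq_trans (canon_sum cn) an.
have opt := optimal_canon_min aopt cn.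
have vi i : (i < size ns)%N -> Vmin R ns <= Fval R (incr ns i).
  move=> lis; rewrite -VA_incr//.
  exact: (@bigmin_le _ _ _ _ (Ordinal lis) (fun j : 'I_(size ns) => VA R ns j.+1)).
have vr : Vmin R ns <= Fval R (rcons ns 1%N) by rewrite -Vinf_rcons bigmin_le_id.
(* [Vmin] bounds the value of every sequence admissible for [n.+1] points, so any candidate that
   realizes it is minimal. *)
have lb := greedy pns sns opt vi vr.
split=> [[//|m] /= lms eV|eV]; apply: canonical_seq_min.
- by rewrite -/(incr ns m) size_incr.
- exact: posseq_incr.
- by rewrite -/(incr ns m) sumn_incr.
- by rewrite -/(incr ns m) -VA_incr// -eV.
- by rewrite size_rcons.
- by rewrite /posseq all_rcons.
- by rewrite sumn_rcons addn1.
- by rewrite -Vinf_rcons -eV.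
Qed.
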